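(* Let the filtered space and notation be as in the context. Let $\sigma=(\sigma_I)_{I\in\mathscr D}$ be a finite sequence (only finitely many nonzero terms) with $|\sigma_I|\le1$, and let $T=T_\sigma$. Let $\mu_1,\mu_2$ be measures on $\mathcal X$ such that $$[\mu_1,\mu_2]_{A_2}:=\sup_{I\in\mathscr D}|I|^{-2}\mu_1(I)\mu_2(I)<\infty .$$ Assume that for all $I\in\mathscr D$ $$\|T_I(\mathbf 1_I\mu_1)\|_{L^2(\mu_2)}\le A\,\mu_1(I)^{1/2},\qquad \|T_I(\mathbf 1_I\mu_2)\|_{L^2(\mu_1)}\le A\,\mu_2(I)^{1/2}.$$ Then for all $f\in L^2(\mu_1)$ $$\|T(f\mu_1)\|_{L^2(\mu_2)}\le\big(2[\mu_1,\mu_2]_{A_2}^{1/2}+5A\big)\|f\|_{L^2(\mu_1)} .$$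
   Context: Let $(\mathcal X,\mathfrak S,\nu)$ be a $\sigma$-finite measure space with a filtration $(\mathfrak S_n)_{n\in\mathbb Z}$, $\mathfrak S_n\subset\mathfrak S_{n+1}$, generating $\mathfrak S$, each $\mathfrak S_n$ atomic with countable disjoint family of atoms $\mathscr D_n$ of positive $\nu$-measure; $\mathscr D=\bigcup_n\mathscr D_n$ (no atom lies in all $\mathscr D_n$). Write $|I|=\nu(I)$. For $I\in\mathscr D$, $\operatorname{rk}_+(I)=\sup\{n:I\in\mathscr D_n\}$ and the children $\operatorname{ch}(I)$ are the $I'\in\mathscr D_{\operatorname{rk}_+(I)+1}$ with $I'\subset I$ ($\operatorname{ch}(I)=\{I\}$ if $\operatorname{rk}_+(I)=\infty$); $\mathscr D(I)=\{I'\in\mathscr D:I'\subset I\}$. For a measure $\mu$ and $f\in L^1(I,\mu)$ set $\mathbb E_I(f\mu)=\big(|I|^{-1}\int_I f\,d\mu\big)\mathbf 1_I$ and $\Delta_I(f\mu)=\sum_{I'\in\operatorname{ch}(I)}\mathbb E_{I'}(f\mu)-\mathbb E_I(f\mu)$. The martingale multiplier is $T_\sigma(f\mu)=\sum_{I\in\mathscr D}\sigma_I\Delta_I(f\mu)$, and $T_I(f\mu)=\sum_{I'\in\mathscr D(I)}\sigma_{I'}\Delta_{I'}(f\mu)$. *)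

(* Defs.v *)
From HB Require Import structures.
From mathcomp Require Import all_boot all_order all_algebra.
From mathcomp Require Import all_classical all_reals all_analysis.
Set Implicit Arguments. Unset Strict Implicit. Unset Printing Implicit Defensive.
Import Order.TTheory GRing.Theory Num.Theory.
Local Open Scope classical_set_scope.
Local Open Scope ring_scope.

Section Martingale.
Context {d : measure_display} {T : measurableType d} {R : realType}.

(* A filtration of atomic sigma-algebras S_n = sigma(D n), n : int,
   described by the countable families D n of atoms. *)
Definition atomic_filtration (nu : {measure set T -> \bar R})
    (D : int -> set (set T)) : Prop :=
      (forall n, countable (D n)) /\
      (forall n I J, D n I -> D n J -> (I `&` J) !=set0 -> I = J) /\
      (forall n, \bigcup_(I in D n) I = setT) /\
      (forall n I, D n I -> measurable I /\ (0 < nu I)%E /\ (nu I < +oo)%E) /\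
      (forall n, <<s D n >> `<=` <<s D (n + 1) >>) /\
      (@measurable d T = <<s \bigcup_n D n >>) /\
      (forall I, ~ (forall n, D n I)).

Variable D : int -> set (set T).

Definition Dall : set (set T) := \bigcup_n D n.

Definition msr (nu : {measure set T -> \bar R}) (I : set T) : R := fine (nu I).

Definition rkp (I : set T) (n : int) : Prop :=
  D n I /\ (forall m, D m I -> m <= n).

(* children of I; ch I = [set I] when rk_+(I) = +oo *)
Definition ch (I : set T) : set (set T) :=
  [set J | (exists n, rkp I n /\ D (n + 1) J /\ J `<=` I) \/
           ((~ exists n, rkp I n) /\ J = I)].

Definition Dsub (I : set T) : set (set T) := [set J | Dall J /\ J `<=` I].

Variable nu : {measure set T -> \bar R}.

Definition EI (I : set T) (f : T -> R) (mu : {measure set T -> \bar R}) : T -> R :=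
  fun x => (fine (\int[mu]_(y in I) (f y)%:E) / msr nu I) * \1_I x.

(* Delta_I(f mu) = sum_{I' in ch I} E_I'(f mu) - E_I(f mu)
   (the sum over the countable disjoint family ch I has at most one
    nonzero term at each point, so the finite-support sum is the pointwise sum) *)
Definition DeltaI (I : set T) (f : T -> R) (mu : {measure set T -> \bar R}) : T -> R :=
  fun x => (\sum_(J \in ch I) EI J f mu x) - EI I f mu x.

Variable sigma : set T -> R.

(* T_sigma(f mu) (sigma has finitely many nonzero terms) *)
Definition Tsig (f : T -> R) (mu : {measure set T -> \bar R}) : T -> R :=
  fun x => \sum_(I \in Dall) sigma I * DeltaI I f mu x.

Definition TI (I : set T) (f : T -> R) (mu : {measure set T -> \bar R}) : T -> R :=
  fun x => \sum_(J \in Dsub I) sigma J * DeltaI J f mu x.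

Definition A2 (mu1 mu2 : {measure set T -> \bar R}) : \bar R :=
  ereal_sup [set ((msr mu1 I * msr mu2 I) / (msr nu I) ^+ 2)%:E | I in Dall].

End Martingale.

Notation L2norm mu f := (Lnorm mu 2%:E (EFin \o f)).

(* Main.v *)
(** Let [N <= n < M] contain the ranks of the finitely many atoms with
    [sigma I != 0].  At a point [x] the sums defining [T] and [T_I] telescope along
    the atoms containing [x] into
      sum_n sigma(I_n(x)) (E_{n+1} - E_n)(f mu)(x),
    which gives a recursion from an atom to its children.  The estimate is a Bellman
    function argument along this recursion.  For an atom [I] put [x = <f>_{I,mu1}],
    [y = <g>_{I,mu2}], [t = <T_I mu1, 1_I>_{mu2} = <1_I, T_I mu2>_{mu1}], and let [V]
    and [U] be the variances over [I] of [T_I mu1] in [L^2(mu2)] and of [T_I mu2] in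
    [L^2(mu1)].  With [C = [mu1,mu2]_{A_2}^{1/2} + A], one proves by induction from
    the finest level upwards that
      <T_I(f mu1), g>_{mu2} - x y t
        <= (C/2 + A) (||f - x||^2 + ||g - y||^2)
         + A (||f||^2 - (int_I f dmu1)^2 / (mu1(I) + V/A^2))
         + A (||g||^2 - (int_I g dmu2)^2 / (mu2(I) + U/A^2)).
    The first line controls the diagonal of the two weighted martingale expansions
    and half of each paraproduct; the last two terms are the Bellman function of the
    Carleson embedding theorem, the decrements of [V] and [U] being the Carleson
    sequences, with [V <= A^2 mu1(I)] and [U <= A^2 mu2(I)] by the testing
    conditions.  To pass from children to parent, each concave quantity is replaced
    by its tangent at the parent's value, so that both sides become countably
    additive in the child.  The result is
    [<T(f mu1), g>_{mu2} <= (C + 4A)/2 (||f||^2 + ||g||^2)], and choosing [g]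
    proportional to [T(f mu1)] gives the theorem, even with
    [[mu1,mu2]_{A_2}^{1/2} + 5A]. *)

Require Import Defs.
From HB Require Import structures.
From mathcomp Require Import all_boot all_order all_algebra.
From mathcomp Require Import all_classical all_reals all_analysis.
From mathcomp Require Import measurable_realfun ring lra zify.
Import Order.TTheory GRing.Theory Num.Theory.
Import numFieldNormedType.Exports.
Local Open Scope classical_set_scope.
Local Open Scope ring_scope.

Set Implicit Arguments.
Unset Strict Implicit.

(** * Atoms and telescoping *)

Section Atoms.
Context {d : measure_display} {T : measurableType d} {R : realType}.
Variables (nu : {measure set T -> \bar R}) (D : int -> set (set T)).
Hypothesis HD : atomic_filtration nu D.

(** This is I_n(x). The default [set0] is never taken, because the atoms of each level cover the
    space. *)
Definition atom_at (n : int) (x : T) : set T :=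
  xget set0 [set I | D n I /\ I x].

Lemma atom_atP n x : D n (atom_at n x) /\ atom_at n x x.
Proof.
case: HD => _ [_] [cov] _; rewrite /atom_at; case: xgetP => [I -> //|noI].
have : (\bigcup_(I in D n) I) x by rewrite cov.
by move=> [I DI Ix]; case: (noI I).
Qed.

Lemma atom_at_eq n I x : D n I -> I x -> atom_at n x = I.
Proof.
move=> DI Ix; case: HD => _ [dis] _; have [Da ax] := atom_atP n x.
by apply: (dis n) => //; exists x.
Qed.

Lemma atom_meas n I : D n I -> measurable I.
Proof. by case: HD => _ [_] [_] [H] _ /H[]. Qed.

Lemma nu_atom_gt0 n I : D n I -> 0 < msr nu I.
Proof.
case: HD => _ [_] [_] [H] _ /H[_ [nu0 nuoo]].
by rewrite /msr fine_gt0// nu0.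
Qed.

(** The sets that contain every level n+1 atom they meet form a sigma-algebra. It contains
    [D (n + 1)], hence the generated sigma-algebra, hence [I]. *)
Lemma nested_succ n I J : D n I -> D (n + 1) J -> (I `&` J) !=set0 -> J `<=` I.
Proof.
case: HD => _ [dis] [cov] [_] [incl] _ DI DJ.
pose G := [set E : set T | forall K, D (n + 1) K -> (E `&` K) !=set0 -> K `<=` E].
have /incl IS : <<s D n >> I by apply: sub_sigma_algebra.
suff /(_ I IS) GI : <<s D (n + 1) >> `<=` G by apply: GI.
apply: smallest_sub; last first.
  by move=> E DE K DK /(dis _ _ _ DE DK) ->.
split.
- by move=> K _ [x []].
- move=> E GE K DK [x [[_ nEx] Kx]] y Ky; split => // Ey; apply: nEx.
  by apply: (GE K DK) => //; exists y.
- move=> F GF K DK [x [[i _ Fix] Kx]] y Ky; exists i => //.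
  by apply: (GF i K DK) => //; exists x.
Qed.

Lemma atom_at_succ n x : atom_at (n + 1) x `<=` atom_at n x.
Proof.
have [Da ax] := atom_atP n x; have [Db bx] := atom_atP (n + 1) x.
by apply: (nested_succ Da Db); exists x.
Qed.

Lemma atom_at_le n m x : n <= m -> atom_at m x `<=` atom_at n x.
Proof.
move=> nm; have [k ->] : exists k : nat, m = n + k%:Z.
  by exists `|m - n|%N; lia.
elim: k => [|k IH]; first by rewrite addr0.
have -> : n + k.+1%:Z = n + k%:Z + 1 by lia.
exact: subset_trans (@atom_at_succ _ x) IH.
Qed.

Lemma nested n m I J : n <= m -> D n I -> D m J -> (I `&` J) !=set0 -> J `<=` I.
Proof.
move=> nm DI DJ [x [Ix Jx]].
by rewrite -(atom_at_eq DI Ix) -(atom_at_eq DJ Jx); exact: atom_at_le.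
Qed.

Lemma atom_nonempty I : Dall D I -> I !=set0.
Proof.
move=> [n _ DI]; apply/set0P/eqP => I0.
by have := nu_atom_gt0 DI; rewrite I0 /msr measure0 ltxx.
Qed.

Lemma atom_between n p m I : n <= p -> p <= m -> D n I -> D m I -> D p I.
Proof.
move=> np pm Dn Dm.
have [x Ix] : I !=set0 by apply: atom_nonempty; exists n.
have [Dp px] := atom_atP p x.
suff <- : atom_at p x = I by [].
apply/seteqP; split.
  by apply: (nested np Dn Dp); exists x.
by apply: (nested pm Dp Dm); exists x.
Qed.

(** A set that is an atom of two levels is an atom of all levels in between, so an atom that shrinks
    at the next step never reappears later. *)
Lemma rkp_succ n x : atom_at (n + 1) x <> atom_at n x -> rkp D (atom_at n x) n.
Proof.
move=> neq; have [Dn nx] := atom_atP n x; split=> // m Dm.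
rewrite leNgt; apply/negP => nm; apply: neq; apply: atom_at_eq => //.
by apply: (atom_between _ _ Dn Dm); lia.
Qed.

Lemma rkp_uniq I n m : rkp D I n -> rkp D I m -> n = m.
Proof.
by move=> [Dn nmax] [Dm mmax]; apply/eqP; rewrite eq_le nmax// mmax.
Qed.

(** * Pointwise telescoping of the multiplier *)

Section Multiplier.
Variables (sigma : set T -> R) (f : T -> R) (mu : {measure set T -> \bar R}).

Definition avg (I : set T) : R := Rintegral mu I f / msr nu I.

Lemma EI_out I x : ~ I x -> EI nu I f mu x = 0.
Proof. by move=> nIx; rewrite /EI indicE memNset// mulr0. Qed.

Lemma EI_in I (x : T) : I x -> EI nu I f mu x = avg I.
Proof. by move=> Ix; rewrite /EI indicE mem_set// mulr1. Qed.

Lemma ch_sub I J : ch D I J -> J `<=` I.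
Proof. by move=> [[n [_ []]]//|[_ ->]]. Qed.

Lemma DeltaI_out I x : ~ I x -> DeltaI D nu I f mu x = 0.
Proof.
move=> nIx; rewrite /DeltaI EI_out// subr0; apply: fsbig1 => J /ch_sub JI.
by apply: EI_out => /JI.
Qed.

Lemma DeltaI_rank_infinite I x : (~ exists n, rkp D I n) -> DeltaI D nu I f mu x = 0.
Proof.
move=> norank; rewrite /DeltaI.
suff -> : ch D I = [set I] by rewrite fsbig_set1 subrr.
apply/seteqP; split => J; first by move=> [[n [rI _]]|[]//]; case: norank; exists n.
by move=> ->; right.
Qed.

Lemma DeltaI_in I n x : rkp D I n -> I x ->
  DeltaI D nu I f mu x = avg (atom_at (n + 1) x) - avg I.
Proof.
move=> rI Ix; rewrite /DeltaI (EI_in Ix); congr (_ - _).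
have [Db bx] := atom_atP (n + 1) x.
rewrite -(EI_in bx).
transitivity (\sum_(J \in [set atom_at (n + 1) x]) EI nu J f mu x); last first.
  by rewrite fsbig_set1.
apply/esym/fsbig_widen => J.
  move=> ->; left; exists n; split=> //; split=> //.
  by apply: (nested_succ (proj1 rI)) => //; exists x.
move=> [[[m [rI' [DJ _]]]|[norank _]] nJ]; last by case: norank; exists n.
apply: EI_out => Jx; apply: nJ.
by rewrite (rkp_uniq rI rI') /= (atom_at_eq DJ Jx).
Qed.

Variable M : int.
(** Levels are counted downwards from [M], so that passing from an atom to its parent is the
    successor step of an induction on [k]. *)
Definition level (k : nat) : int := M - k%:Z.

Lemma levelS k : level k = level k.+1 + 1.
Proof. rewrite /level; lia. Qed.

(** The telescoped value at [x] of T_I, for I the atom of level [level k] through [x]. If an atom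
    persists over several levels, the repeated differences are zero, so its weight is counted
    once. *)
Fixpoint Tlev (k : nat) (x : T) : R :=
  if k is k'.+1 then
    sigma (atom_at (level k) x) *
      (avg (atom_at (level k') x) - avg (atom_at (level k) x)) + Tlev k' x
  else 0.

Hypothesis Sfin : finite_set [set I | Dall D I /\ sigma I != 0].
Hypothesis rank_lt : forall I n, rkp D I n -> sigma I != 0 -> n < M.

Lemma TI_Tlev k x : TI D nu sigma (atom_at (level k) x) f mu x = Tlev k x.
Proof.
elim: k => [|k IH] /=.
  rewrite /TI; apply: fsbig1 => J [[n _ DJ] JI].
  have [Jx|/DeltaI_out ->] := pselect (J x); last by rewrite mulr0.
  have [/eqP -> |sJ] := boolP (sigma J == 0); first by rewrite mul0r.
  have [rJ|/DeltaI_rank_infinite ->] := pselect (exists n, rkp D J n); last by rewrite mulr0.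
  have [m rJm] := rJ; have mM := rank_lt rJm sJ.
  have [Dm mmax] := rJm.
  have [Da ax] := atom_atP (level 0) x.
  (* The rank of [J] is below [M], so [J] contains the level [M] atom of [x]; it also lies in it by
     [JI]. Being that atom contradicts its rank. *)
  have JE : J = atom_at (level 0) x.
    apply/seteqP; split=> //; apply: (nested _ Dm Da); last by exists x.
    by rewrite /level; lia.
  have := mmax (level 0); rewrite JE => /(_ Da).
  by rewrite /level; lia.
set I := atom_at (level k.+1) x; set I' := atom_at (level k) x in IH *.
have [DI Ix] := atom_atP (level k.+1) x; rewrite -/I in DI Ix.
have [DI' I'x] := atom_atP (level k) x; rewrite -/I' in DI' I'x.
have I'I : I' `<=` I by rewrite /I' /I levelS; exact: atom_at_succ.
rewrite -IH.
have [E|neq] := pselect (I' = I); first by rewrite E subrr mulr0 add0r.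
have rI : rkp D I (level k.+1).
  by apply: rkp_succ; rewrite -levelS.
rewrite {1}/I' levelS -(DeltaI_in rI Ix) /TI.
pose F J := sigma J * DeltaI D nu J f mu x.
pose S := [set J | Dall D J /\ sigma J != 0].
(* Splitting off one term requires a finite index set: atoms of weight zero are discarded, and [I]
   is put back by hand since its weight may vanish. *)
pose P := I |` (Dsub D I `&` S).
have IsubI : Dsub D I I by split=> //; exists (level k.+1).
rewrite -[LHS](@fsbig_widen _ _ _ _ P (Dsub D I) F); last 2 first.
- by move=> J [->//|[]].
- move=> J [DJ nPJ] /=; rewrite /F.
  have [/eqP -> |sJ] := boolP (sigma J == 0); first by rewrite mul0r.
  by case: nPJ; right; split => //; split => //; case: DJ.
have Pfin : finite_set P.
  by rewrite finite_setU; split=> //; apply: sub_finite_set Sfin => J [].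
rewrite (fsbigD1 I)//; last by left.
congr (_ + _).
pose Q := (Dsub D I' `&` S).
rewrite -[RHS](@fsbig_widen _ _ _ _ Q (Dsub D I') F); last 2 first.
- by move=> J [].
- move=> J [DJ nPJ] /=; rewrite /F.
  have [/eqP -> |sJ] := boolP (sigma J == 0); first by rewrite mul0r.
  by case: nPJ; split => //; split => //; case: DJ.
apply/esym/fsbig_widen => J.
  move=> [[DJ JI'] SJ]; split.
    by right; split=> //; split=> //; apply: subset_trans I'I.
  by move=> JI; apply: neq; apply/seteqP; split=> //; rewrite -JI.
move=> [[[JI|[[DJ JI] SJ]] nJI] nQ] //=; rewrite /F.
have [Jx|/DeltaI_out ->] := pselect (J x); last by rewrite mulr0.
case: nQ; split=> //; split=> //; case: DJ => m _ Dm.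
(* An atom through [x] inside [I] is [I] itself if its level is at most that of [I]; otherwise it
   lies in [I']. *)
have [ml|lm] := leP m (level k.+1).
  case: nJI; apply/seteqP; split => //.
  by apply: (nested ml Dm DI); exists x.
by apply: (nested _ DI' Dm); [rewrite levelS; lia|exists x].
Qed.

Lemma Tsig_Tlev K x : (forall I n, rkp D I n -> sigma I != 0 -> level K <= n) ->
  Tsig D nu sigma f mu x = Tlev K x.
Proof.
move=> rank_ge; rewrite -TI_Tlev.
apply/esym/fsbig_widen => J; first by case.
move=> [DJ nJ] /=.
have [Jx|/DeltaI_out ->] := pselect (J x); last by rewrite mulr0.
have [/eqP -> |sJ] := boolP (sigma J == 0); first by rewrite mul0r.
have [[n rJ]|/DeltaI_rank_infinite ->] := pselect (exists n, rkp D J n); last by rewrite mulr0.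
have Kn := rank_ge _ _ rJ sJ; case: nJ; split=> //.
have [Da ax] := atom_atP (level K) x.
by apply: (nested Kn Da (proj1 rJ)); exists x.
Qed.

End Multiplier.
End Atoms.

(** * Countable additivity and locally square integrable functions *)

(** An injection of [C] into the naturals gives the indices; an index that is not hit receives the
    empty union. Hence the case [e k = set0] in all later sums. *)
Lemma disjoint_family_enum (T : Type) (C : set (set T)) : countable C ->
  (forall I J, C I -> C J -> (I `&` J) !=set0 -> I = J) ->
  exists e : nat -> set T, [/\ trivIset setT e,
    \bigcup_k e k = \bigcup_(I in C) I & forall k, e k = set0 \/ C (e k)].
Proof.
move=> /countable_injP[c cinj] dis.
pose e k := \bigcup_(I in [set J | C J /\ c J = k]) I.
have eE I : C I -> e (c I) = I.
  move=> CI; apply/seteqP; split=> x; last by move=> Ix; exists I.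
  by move=> [J [CJ cJ] Jx]; rewrite -(cinj J I)// inE.
exists e; split.
- apply/trivIsetP => i j _ _ ij; apply/seteqP; split=> x //.
  move=> [[I [CI cI] Ix] [J [CJ cJ] Jx]].
  by move: ij; rewrite -cI -cJ (dis I J)// ?eqxx//; exists x.
- apply/seteqP; split=> x.
    by move=> [k _ [I [CI _] Ix]]; exists I.
  by move=> [I CI Ix]; exists (c I) => //; rewrite eE.
- move=> k; have [[I [CI <-]]|no] := pselect (exists I, C I /\ c I = k).
    by right; rewrite eE.
  left; apply/seteqP; split=> x // [I CI _]; case: no; by exists I.
Qed.

Section Enumeration.
Context {d : measure_display} {T : measurableType d} {R : realType}.

Lemma ge0_le_integral_bigcup (mu1 mu2 : {measure set T -> \bar R})
    (e : nat -> set T) (p q : T -> \bar R) :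
  trivIset setT e -> (forall k, measurable (e k)) ->
  measurable_fun setT p -> measurable_fun setT q ->
  (forall x, 0 <= p x)%E -> (forall x, 0 <= q x)%E ->
  (forall k, \int[mu2]_(x in e k) p x <= \int[mu1]_(x in e k) q x)%E ->
  (\int[mu2]_(x in \bigcup_k e k) p x <= \int[mu1]_(x in \bigcup_k e k) q x)%E.
Proof.
move=> te me mp mq p0 q0 le.
have ms r : measurable_fun setT (r : T -> \bar R) -> measurable_fun (\bigcup_k e k) r.
  by move=> mr; apply: measurable_funS mr => //; apply: bigcup_measurable.
rewrite !ge0_integral_bigcup//; [|exact: ms|exact: ms].
apply: lee_nneseries => [i _ _|i _]; last exact: le.
exact: integral_ge0.
Qed.

(** This is the form in which inequalities pass from children to parent: the property is stable
    under linear combinations, and nonnegativity on the pieces gives nonnegativity on [I]. *)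
Definition countably_additive_along (e : nat -> set T) (I : set T)
    (psi : set T -> R) : Prop :=
  (\sum_(0 <= k < m) psi (e k)) @[m --> \oo] --> psi I.

Lemma caddD e I psi phi : countably_additive_along e I psi ->
  countably_additive_along e I phi ->
  countably_additive_along e I (fun J => psi J + phi J).
Proof.
move=> hpsi hphi; rewrite /countably_additive_along.
under eq_cvg do rewrite big_split /=.
exact: cvgD.
Qed.

Lemma caddZ e I c psi : countably_additive_along e I psi ->
  countably_additive_along e I (fun J => c * psi J).
Proof.
move=> hpsi; rewrite /countably_additive_along.
under eq_cvg do rewrite -mulr_sumr.
exact: cvgMr.
Qed.

Lemma caddZr e I c psi : countably_additive_along e I psi ->
  countably_additive_along e I (fun J => psi J * c).
Proof.
move=> /(caddZ (c := c)); congr (countably_additive_along e I _).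
by apply/funext => J; rewrite mulrC.
Qed.

Lemma caddB e I psi phi : countably_additive_along e I psi ->
  countably_additive_along e I phi ->
  countably_additive_along e I (fun J => psi J - phi J).
Proof.
move=> hpsi hphi; rewrite /countably_additive_along.
under eq_cvg do rewrite sumrB /=.
exact: cvgB.
Qed.

Lemma cadd_ge0 e I psi : countably_additive_along e I psi ->
  (forall k, 0 <= psi (e k)) -> 0 <= psi I.
Proof.
move=> hpsi psi0.
have : 0 <= limn (fun m => \sum_(0 <= k < m) psi (e k)).
  apply: limr_ge; first by apply/cvg_ex; exists (psi I).
  by near=> m; apply: sumr_ge0.
by rewrite (cvg_lim _ hpsi).
Unshelve. all: by end_near. Qed.

Lemma cadd_eq0 e I psi : countably_additive_along e I psi ->
  (forall k, psi (e k) = 0) -> psi I = 0.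
Proof.
move=> hpsi psi0; apply/eqP; rewrite eq_le (cadd_ge0 hpsi) ?andbT; last first.
  by move=> k; rewrite psi0.
have /= := cadd_ge0 (caddZ (c := -1) hpsi); rewrite mulN1r oppr_ge0; apply=> k.
by rewrite psi0 mulr0.
Qed.

Lemma cadd_ge0_Rintegral (mu : {measure set T -> \bar R}) e f :
  trivIset setT e -> (forall k, measurable (e k)) -> (forall x, 0 <= f x) ->
  mu.-integrable (\bigcup_k e k) (EFin \o f) ->
  countably_additive_along e (\bigcup_k e k) (fun J => Rintegral mu J f).
Proof.
move=> te me f0 intf; rewrite /countably_additive_along.
have mU : measurable (\bigcup_k e k) by apply: bigcup_measurable.
have fin k : (\int[mu]_(x in e k) (f x)%:E)%E \is a fin_num.
  apply: integrable_fin_num => //.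
  by apply: integrableS intf => // x; exists k.
have -> : (fun m => \sum_(0 <= k < m) Rintegral mu (e k) f) =
   fine \o (fun m => \sum_(0 <= k < m) \int[mu]_(x in e k) (f x)%:E)%E.
  by apply/funext => m /=; rewrite -sum_fine.
apply: fine_cvg; rewrite fineK; last exact: integrable_fin_num.
rewrite (integral_bigcup te me intf).
apply: is_cvg_ereal_nneg_natsum_cond => n _ _; apply: integral_ge0 => x _.
by rewrite lee_fin.
Qed.

(** Write f = (f + |f|) - |f|, a difference of nonnegative integrable functions. *)
Lemma cadd_Rintegral (mu : {measure set T -> \bar R}) e f :
  trivIset setT e -> (forall k, measurable (e k)) ->
  mu.-integrable (\bigcup_k e k) (EFin \o f) ->
  countably_additive_along e (\bigcup_k e k) (fun J => Rintegral mu J f).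
Proof.
move=> te me intf; have mU : measurable (\bigcup_k e k) by apply: bigcup_measurable.
have intabs : mu.-integrable (\bigcup_k e k) (EFin \o (fun x => `|f x|)).
  exact: integrable_abse intf.
have intD : mu.-integrable (\bigcup_k e k) (EFin \o (fun x => f x + `|f x|)).
  exact: integrableD intf intabs.
have split J : measurable J -> J `<=` \bigcup_k e k ->
    Rintegral mu J f = Rintegral mu J (fun x => f x + `|f x|) - Rintegral mu J (fun x => `|f x|).
  move=> mJ JU; have intJ g := @integrableS _ _ _ mu _ _ g mU mJ JU.
  by rewrite RintegralD//; [rewrite addrK| exact: intJ| exact: intJ].
have f1 x : 0 <= f x + `|f x| by have := ler_norm (- f x); rewrite normrN; lra.
have f2 x : 0 <= `|f x| by [].
have := caddB (cadd_ge0_Rintegral te me f1 intD) (cadd_ge0_Rintegral te me f2 intabs).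
rewrite /countably_additive_along -split//.
suff -> : (fun m => \sum_(0 <= k < m) Rintegral mu (e k) f) =
   (fun m => \sum_(0 <= k < m) (Rintegral mu (e k) (fun x => f x + `|f x|)
                               - Rintegral mu (e k) (fun x => `|f x|))) by [].
by apply/funext => m; apply: eq_bigr => k _; apply: split => // x; exists k.
Qed.
End Enumeration.

(** * Functions square integrable on every atom, and their pairings *)

Section LocallySquareIntegrable.
Context {d : measure_display} {T : measurableType d} {R : realType}.
Variables (nu : {measure set T -> \bar R}) (D : int -> set (set T)).
Hypothesis HD : atomic_filtration nu D.

Definition locL2 (mu : {measure set T -> \bar R}) (f : T -> R) : Prop :=
  measurable_fun setT f /\
  forall I, Dall D I -> (\int[mu]_(x in I) ((f x) ^+ 2)%:E < +oo)%E.

Lemma Dall_meas I : Dall D I -> measurable I.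
Proof. by move=> [n _]; apply: (atom_meas HD). Qed.

Section OneMeasure.
Variable mu : {measure set T -> \bar R}.

Lemma locL2_sq f I : locL2 mu f -> Dall D I ->
  mu.-integrable I (EFin \o (fun x => f x ^+ 2)).
Proof.
move=> [mf finf] DI; apply/integrableP; split.
  apply/measurable_EFinP; apply: measurable_funX.
  exact: measurable_funTS.
under eq_integral do rewrite /= ger0_norm ?sqr_ge0//.
exact: finf.
Qed.

Lemma locL2_mul f g I : locL2 mu f -> locL2 mu g -> Dall D I ->
  mu.-integrable I (EFin \o (fun x => f x * g x)).
Proof.
move=> hf hg DI; have mI := Dall_meas DI.
apply: (@le_integrable _ _ _ _ _ mI _ (EFin \o (fun x => f x ^+ 2 + g x ^+ 2))).
- apply/measurable_EFinP; apply: measurable_funM.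
    exact: (measurable_funTS hf.1).
  exact: (measurable_funTS hg.1).
- move=> x _ /=; rewrite lee_fin [leRHS]ger0_norm ?addr_ge0 ?sqr_ge0// ler_norml.
  by apply/andP; split; nra.
- exact: integrableD (locL2_sq hf DI) (locL2_sq hg DI).
Qed.

Lemma locL2Z c f : locL2 mu f -> locL2 mu (fun x => c * f x).
Proof.
move=> hf; split=> [|I DI].
  by apply: measurable_funM => //; exact: hf.1.
under eq_integral do rewrite exprMn EFinM.
rewrite integralZl//; [|exact: Dall_meas|exact: locL2_sq].
by apply: lte_mul_pinfty => //; [rewrite lee_fin sqr_ge0|exact: hf.2].
Qed.

Lemma locL2D f g : locL2 mu f -> locL2 mu g -> locL2 mu (fun x => f x + g x).
Proof.
move=> hf hg; split=> [|I DI].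
  by apply: measurable_funD; [exact: hf.1|exact: hg.1].
have h1 := locL2_sq hf DI; have h2 := locL2_sq hg DI.
have h3 := locL2_mul (locL2Z 2 hf) hg DI.
have h4 := integrableD (Dall_meas DI) (integrableD (Dall_meas DI) h1 h2) h3.
have := integrable_fin_num (Dall_meas DI) h4.
rewrite fin_numE => /andP[_]; rewrite -ltey; congr (_ < _)%E.
by apply: eq_integral => x _ /=; congr (_%:E); ring.
Qed.

Hypothesis mufin : forall I, Dall D I -> (mu I < +oo)%E.

Lemma locL2_cst c : locL2 mu (fun=> c).
Proof.
split=> // I DI; rewrite integral_cst//; last exact: Dall_meas.
by apply: lte_mul_pinfty; [rewrite lee_fin sqr_ge0| |exact: mufin].
Qed.

Definition ip (I : set T) (f g : T -> R) : R := Rintegral mu I (fun x => f x * g x).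

Lemma ipC I f g : ip I f g = ip I g f.
Proof. by apply: eq_Rintegral => x _; rewrite mulrC. Qed.

Lemma ip0 f g : ip set0 f g = 0.
Proof. by rewrite /ip Rintegral_set0. Qed.

Lemma eq_ip I f f' g : (forall x, I x -> f x = f' x) -> ip I f g = ip I f' g.
Proof. by move=> ff; apply: eq_Rintegral => x; rewrite inE => /ff ->. Qed.

Lemma ipDl I f g h : Dall D I -> locL2 mu f -> locL2 mu g -> locL2 mu h ->
  ip I (fun x => f x + g x) h = ip I f h + ip I g h.
Proof.
move=> DI hf hg hh; rewrite /ip -RintegralD; last 3 first.
- exact: Dall_meas.
- exact: locL2_mul.
- exact: locL2_mul.
by apply: eq_Rintegral => x _; rewrite mulrDl.
Qed.

Lemma ipZl I c f g : Dall D I -> locL2 mu f -> locL2 mu g ->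
  ip I (fun x => c * f x) g = c * ip I f g.
Proof.
move=> DI hf hg; rewrite /ip -RintegralZl; last 2 first.
- exact: Dall_meas.
- exact: locL2_mul.
by apply: eq_Rintegral => x _; rewrite mulrA.
Qed.

Lemma ip_ge0 I f : 0 <= ip I f f.
Proof. by apply: Rintegral_ge0 => x _; rewrite -expr2 sqr_ge0. Qed.

Lemma ip_addZ I c f g h : Dall D I -> locL2 mu f -> locL2 mu g -> locL2 mu h ->
  ip I (fun x => c * f x + g x) h = c * ip I f h + ip I g h.
Proof. by move=> DI hf hg hh; rewrite ipDl ?ipZl//; exact: locL2Z. Qed.

Lemma ip_sqr_addZ I c f g : Dall D I -> locL2 mu f -> locL2 mu g ->
  ip I (fun x => c * f x + g x) (fun x => c * f x + g x) =
  c ^+ 2 * ip I f f + 2 * c * ip I f g + ip I g g.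
Proof.
move=> DI hf hg; have hfg : locL2 mu (fun x => c * f x + g x).
  by apply: locL2D => //; exact: locL2Z.
rewrite ip_addZ// (ipC I f) (ipC I g) !ip_addZ// (ipC I g f); ring.
Qed.

Lemma cauchy_schwarz I f g : Dall D I -> locL2 mu f -> locL2 mu g ->
  ip I f g ^+ 2 <= ip I f f * ip I g g.
Proof.
move=> DI hf hg; set P := ip I f f; set Q := ip I f g; set S := ip I g g.
have P0 : 0 <= P := ip_ge0 I f; have S0 : 0 <= S := ip_ge0 I g.
have H c : 0 <= c ^+ 2 * P + 2 * c * Q + S by rewrite -ip_sqr_addZ// ip_ge0.
have [P1|P1] := ltP 0 P.
  have := H (- (Q / P)).
  have -> : (- (Q / P)) ^+ 2 * P + 2 * - (Q / P) * Q + S = S - Q ^+ 2 / P.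
    by field; rewrite gt_eqF.
  by rewrite subr_ge0 ler_pdivrMr// mulrC.
have {P1 P0} P0 : P = 0 by apply/eqP; rewrite eq_le P1.
rewrite P0 mul0r; have [->|Q0] := eqVneq Q 0; first by rewrite expr0n.
(* Without a quadratic term, a nonzero [Q] would let the expression take the value -1 at this
   argument. *)
have := H (- ((S + 1) / (2 * Q))); rewrite P0 mulr0 add0r.
have -> : 2 * - ((S + 1) / (2 * Q)) * Q + S = - 1 by field.
lra.
Qed.

Lemma cadd_ip I e f g : trivIset setT e -> (forall k, measurable (e k)) ->
  \bigcup_k e k = I -> Dall D I -> locL2 mu f -> locL2 mu g ->
  countably_additive_along e I (fun J => ip J f g).
Proof.
move=> te me <- DI hf hg; apply: cadd_Rintegral => //; exact: locL2_mul.
Qed.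

End OneMeasure.

Lemma level_enum n : exists e : nat -> set T, [/\ trivIset setT e,
  forall k, measurable (e k), \bigcup_k e k = setT &
  forall k, e k = set0 \/ D n (e k)].
Proof.
have [cD [dis [cov _]]] := HD.
have [e [te Ue eC]] := disjoint_family_enum (cD n) (@dis n).
exists e; split=> //; last by rewrite Ue cov.
by move=> k; case: (eC k) => [->//|/(atom_meas HD)].
Qed.

Lemma atom_enum n m I : n <= m -> D n I -> exists e : nat -> set T,
  [/\ trivIset setT e, forall k, measurable (e k), \bigcup_k e k = I &
   forall k, e k = set0 \/ (D m (e k) /\ e k `<=` I)].
Proof.
move=> nm DI; have [cD [dis _]] := HD.
have [||e [te Ue eC]] := @disjoint_family_enum _ [set J | D m J /\ J `<=` I].
- by apply: sub_countable (cD m); apply: subset_card_le => J [].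
- by move=> J K [DJ _] [DK _]; exact: (dis m _ _ DJ DK).
exists e; split=> //.
- by move=> k; case: (eC k) => [->//|[/(atom_meas HD)]].
- rewrite Ue; apply/seteqP; split=> x; first by move=> [J [_ JI]] /JI.
  move=> Ix; have [Da ax] := atom_atP HD m x; exists (atom_at D m x) => //.
  by split=> //; apply: (nested HD nm DI Da); exists x.
Qed.

Lemma atomwise_const_measurable n (f : T -> R) :
  (forall I x y, D n I -> I x -> I y -> f x = f y) -> measurable_fun setT f.
Proof.
move=> cf _ Y mY; rewrite setTI.
have [e [te me Ue eD]] := level_enum n.
have -> : f @^-1` Y = \bigcup_(k in [set k | e k `<=` f @^-1` Y]) e k.
  apply/seteqP; split=> x; last by move=> [k sub] /sub.
  move=> Yfx; have : (\bigcup_k e k) x by rewrite Ue.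
  move=> [k _ ekx]; exists k => // y eky /=.
  by case: (eD k) => [e0|Dk]; [rewrite e0 in ekx|rewrite (cf _ _ _ Dk eky ekx)].
exact: bigcup_measurable.
Qed.

(** An atom of level above n lies in a single n-atom, and one of level at most n is a countable
    union of n-atoms; control on one level thus suffices. *)
Lemma locL2_of_level (mu1 mu2 : {measure set T -> \bar R}) n (f u : T -> R) (K : R) :
  0 <= K -> locL2 mu1 f -> measurable_fun setT u ->
  (forall J, D n J -> \int[mu2]_(x in J) (u x ^+ 2)%:E <=
     K%:E * \int[mu1]_(x in J) (f x ^+ 2)%:E)%E -> locL2 mu2 u.
Proof.
move=> K0 hf mu_ le; split=> // I [m _ DI].
have msq (v : T -> R) : measurable_fun setT v ->
    measurable_fun setT (fun x => (v x ^+ 2)%:E).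
  by move=> mv; apply/measurable_EFinP; exact: measurable_funX.
have fin J : Dall D J -> (K%:E * \int[mu1]_(x in J) (f x ^+ 2)%:E < +oo)%E.
  by move=> DJ; apply: lte_mul_pinfty => //; exact: hf.2.
have [mn|nm] := leP m n; last first.
  have [x Ix] : I !=set0 by apply: (atom_nonempty HD); exists m.
  have [Da ax] := atom_atP HD n x.
  have Ia : I `<=` atom_at D n x.
    by apply: (nested HD _ Da DI); [exact: ltW|exists x].
  apply: le_lt_trans (fin _ (ex_intro2 _ _ n Logic.I Da)).
  apply: le_trans (le _ Da); apply: ge0_subset_integral => //.
  - exact: (atom_meas HD DI).
  - exact: (atom_meas HD Da).
  - exact: measurable_funTS (msq _ mu_).
  - by move=> y _; rewrite lee_fin sqr_ge0.
have [e [te me Ue eD]] := atom_enum mn DI.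
have DallI : Dall D I by exists m.
apply: le_lt_trans (fin _ DallI).
have mK : measurable_fun setT (fun x => K%:E * (f x ^+ 2)%:E)%E.
  by apply/measurable_EFinP; apply: measurable_funM => //; apply: measurable_funX; exact: hf.1.
have toint J : measurable J -> (\int[mu1]_(x in J) (K%:E * (f x ^+ 2)%:E) =
   K%:E * \int[mu1]_(x in J) (f x ^+ 2)%:E)%E.
  move=> mJ; apply: ge0_integralZl => //.
  - exact: measurable_funTS (msq _ hf.1).
  - by move=> x _; rewrite lee_fin sqr_ge0.
rewrite -toint; last exact: (atom_meas HD DI).
rewrite -Ue; apply: ge0_le_integral_bigcup => //.
- exact: msq.
- by move=> x; rewrite lee_fin sqr_ge0.
- by move=> x; rewrite mule_ge0// lee_fin// sqr_ge0.
- move=> k; rewrite toint//; case: (eD k) => [->|[Dk _]]; last exact: le.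
  by rewrite !integral_set0 mule0.
Qed.

End LocallySquareIntegrable.

(** * The Bellman inequality *)

Section BellmanAlgebra.
Context {R : realFieldType}.
Implicit Types A C a b f g w h k v x y l t s p q : R.

(** The left side is the tangent plane of the convex function p^2 / s, touching it along p = l s. It
    is linear in (p, s) jointly, hence additive over children. *)
Lemma tangent_le_sqr_div s p l : 0 <= s -> (s = 0 -> p = 0) ->
  2 * l * p - l ^+ 2 * s <= p ^+ 2 / s.
Proof.
rewrite le_eqVlt => /predU1P[<- /(_ erefl) ->|s0 _].
  by rewrite invr0 !mulr0 subrr.
rewrite ler_pdivlMr// -subr_ge0.
have -> : p ^+ 2 - (2 * l * p - l ^+ 2 * s) * s = (p - l * s) ^+ 2 by ring.
exact: sqr_ge0.
Qed.

(** As |w| <= C sqrt(a b), this is the AM-GM inequality for a p^2 and b q^2; squares are compared to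
    avoid roots. *)
Lemma weighted_amgm C a b w p q : 0 <= C -> 0 <= a -> 0 <= b ->
  w ^+ 2 <= C ^+ 2 * (a * b) ->
  p * q * w <= C / 2 * (a * p ^+ 2 + b * q ^+ 2).
Proof.
move=> C0 a0 b0 wab; set r := C / 2 * _.
have ap0 : 0 <= a * p ^+ 2 by rewrite mulr_ge0// sqr_ge0.
have bq0 : 0 <= b * q ^+ 2 by rewrite mulr_ge0// sqr_ge0.
have r0 : 0 <= r by rewrite mulr_ge0 ?addr_ge0 ?divr_ge0.
apply: le_trans (ler_norm _) _; rewrite -ler_sqr ?nnegrE// real_normK ?num_real//.
apply: (@le_trans _ _ (C ^+ 2 * (a * p ^+ 2 * (b * q ^+ 2)))).
  have -> : (p * q * w) ^+ 2 = (p * q) ^+ 2 * w ^+ 2 by ring.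
  have -> : C ^+ 2 * (a * p ^+ 2 * (b * q ^+ 2)) = (p * q) ^+ 2 * (C ^+ 2 * (a * b)) by ring.
  by rewrite ler_wpM2l// sqr_ge0.
have -> : r ^+ 2 = C ^+ 2 * ((a * p ^+ 2 + b * q ^+ 2) / 2) ^+ 2 by rewrite /r; field.
rewrite ler_wpM2l ?sqr_ge0// -subr_ge0.
have -> : ((a * p ^+ 2 + b * q ^+ 2) / 2) ^+ 2 - a * p ^+ 2 * (b * q ^+ 2) =
  ((a * p ^+ 2 - b * q ^+ 2) / 2) ^+ 2 by field.
exact: sqr_ge0.
Qed.

(** Completing the square in [q]. In use, b p^2 is a variance decrement, and the coefficient x^2 /
    (4 A) becomes l^2 / A through the factor 4 of Carleson embedding. *)
Lemma paraproduct_amgm A b x q p : 0 < A -> 0 <= b ->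
  x * q * (b * p) <= A * (b * q ^+ 2) + x ^+ 2 / (4 * A) * (b * p ^+ 2).
Proof.
move=> A0 b0; rewrite -subr_ge0.
have -> : A * (b * q ^+ 2) + x ^+ 2 / (4 * A) * (b * p ^+ 2) - x * q * (b * p) =
  b * A * (q - x / (2 * A) * p) ^+ 2 by field; rewrite gt_eqF.
by rewrite mulr_ge0 ?sqr_ge0// mulr_ge0// ltW.
Qed.

(* [a, b] are the [mu1]- and [mu2]-measures of an atom [I], [F, P] the integrals of
   [f, f^2], [G, Q] those of [g, g^2], [t], [N2], [N1] the integrals of [T_I mu1],
   [(T_I mu1)^2] and [(T_I mu2)^2], so that [N2 - t^2/b] and [N1 - t^2/a] are the
   variances [V] and [U].  On null atoms every quotient is [0], as it should be. *)
Definition bellman_bound (A C a b F G P Q t N2 N1 B : R) : Prop :=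
  B - F / a * (G / b) * t <=
    (C / 2 + A) * (P - F ^+ 2 / a + (Q - G ^+ 2 / b))
    + A * (P - F ^+ 2 / (a + (N2 - t ^+ 2 / b) / A ^+ 2))
    + A * (Q - G ^+ 2 / (b + (N1 - t ^+ 2 / a) / A ^+ 2)).

(* The tangent form of [bellman_bound] on a child, right-hand side minus left-hand
   side.  The parameters belong to the parent: the averages [x, y], the optimal
   slopes [l, e], the means [tau, tau'] of [T_I mu1] and [T_I mu2], [kappa = sigma I],
   and [c1 = mu1(I)/nu(I)], [c2 = mu2(I)/nu(I)].  The arguments [UG, H, K, HH, KK] are
   integrals over the child of the parent's functions [T_I(f mu1) g], [T_I mu1],
   [T_I mu2] and the squares of the last two. *)
Definition bellman_step (A C x y l e tau tau' kappa c1 c2 : R)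
    (a b F G P Q UG H K HH KK : R) : R :=
  (C / 2 + A) * (P - 2 * x * F + x ^+ 2 * a + (Q - 2 * y * G + y ^+ 2 * b))
  + A * (P - 2 * l * F + l ^+ 2 * (a + (HH - 2 * tau * H + tau ^+ 2 * b) / A ^+ 2))
  + A * (Q - 2 * e * G + e ^+ 2 * (b + (KK - 2 * tau' * K + tau' ^+ 2 * a) / A ^+ 2))
  + x * (kappa * c1 + tau) * (G - y * b) + y * (kappa * c2 + tau') * (F - x * a)
  - (UG + kappa * x * c1 * G - x * y * (H + kappa * c1 * b)).

Lemma sqr_le0_eq0 p s : p ^+ 2 <= s -> s = 0 -> p = 0.
Proof.
by move=> ps s0; apply/eqP; rewrite -sqrf_eq0 eq_le sqr_ge0 andbT -s0.
Qed.

Lemma divfK0 p s : (s = 0 -> p = 0) -> p = p / s * s.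
Proof.
have [->|s0 _] := eqVneq s 0; first by move=> /(_ erefl) ->; rewrite !mul0r.
by rewrite divfK.
Qed.

Lemma sub_sqr_div_ge0 b t p : 0 <= b -> 0 <= p -> t ^+ 2 <= p * b -> 0 <= p - t ^+ 2 / b.
Proof.
rewrite le_eqVlt => /predU1P[<-|b0] p0 tp; first by rewrite invr0 mulr0 subr0.
by rewrite subr_ge0 ler_pdivrMr.
Qed.

Lemma quarter_sqr_div_le A x l : 0 < A -> x ^+ 2 <= 4 * l ^+ 2 ->
  x ^+ 2 / (4 * A) <= l ^+ 2 / A.
Proof.
move=> A0 xl; rewrite ler_pdivrMr ?mulr_gt0//.
have -> : l ^+ 2 / A * (4 * A) = 4 * l ^+ 2 by field; rewrite gt_eqF.
by [].
Qed.

(** Here [n] is nu(J) for the child J, and on J the functions T_I mu1, T_I mu2 differ from T_J mu1,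
    T_J mu2 by the constants [de], [de']; the last arguments are therefore the parent's pairings
    over J. *)
Lemma bellman_step_child A C x y l e tau tau' kappa c1 c2 n de de'
    (a b F G P Q t N2 N1 B : R) :
  0 < A -> 0 <= C -> 0 <= a -> 0 <= b ->
  F ^+ 2 <= P * a -> G ^+ 2 <= Q * b -> 0 <= N2 -> 0 <= N1 ->
  t ^+ 2 <= N2 * b -> t ^+ 2 <= N1 * a ->
  (t + kappa * a * b / n) ^+ 2 <= C ^+ 2 * (a * b) ->
  x ^+ 2 <= 4 * l ^+ 2 -> y ^+ 2 <= 4 * e ^+ 2 ->
  bellman_bound A C a b F G P Q t N2 N1 B ->
  de = kappa * (a / n - c1) -> de' = kappa * (b / n - c2) ->
  0 <= bellman_step A C x y l e tau tau' kappa c1 c2 a b F G P Q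
    (B + kappa * (F / n - x * c1) * G) (t + de * b) (t + de' * a)
    (N2 + 2 * de * t + de ^+ 2 * b) (N1 + 2 * de' * t + de' ^+ 2 * a).
Proof.
move=> A0 C0 a0 b0 FP GQ N20 N10 tN2 tN1 wC xl ye IH de_def de'_def.
rewrite /bellman_bound in IH; set V := N2 - t ^+ 2 / b in IH; set U := N1 - t ^+ 2 / a in IH.
have Fa : F = F / a * a.
  by apply: divfK0 => az; apply: (sqr_le0_eq0 FP); rewrite az mulr0.
have Gb : G = G / b * b.
  by apply: divfK0 => bz; apply: (sqr_le0_eq0 GQ); rewrite bz mulr0.
have tb : t = t / b * b.
  by apply: divfK0 => bz; apply: (sqr_le0_eq0 tN2); rewrite bz mulr0.
have ta : t = t / a * a.
  by apply: divfK0 => az; apply: (sqr_le0_eq0 tN1); rewrite az mulr0.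
have V0 : 0 <= V := sub_sqr_div_ge0 b0 N20 tN2.
have U0 : 0 <= U := sub_sqr_div_ge0 a0 N10 tN1.
set f := F / a in Fa IH; set g := G / b in Gb IH.
set w := t + _ in wC; set m := kappa * c1 + tau; set m' := kappa * c2 + tau'.
(* [h] and [m] are the means over child and parent of T_I mu1 + kappa c1, so [h - m] is a martingale
   difference of T_I mu1; likewise [k - m'] for T_I mu2. *)
pose h := t / b + kappa * a / n; pose k := t / a + kappa * b / n.
have wh : w = b * h by rewrite /w /h {1}tb; ring.
have wk : w = a * k by rewrite /w /k {1}ta; ring.
have F2 : F ^+ 2 / a = f * F by rewrite /f expr2; ring.
have G2 : G ^+ 2 / b = g * G by rewrite /g expr2; ring.
have H1 := weighted_amgm (f - x) (g - y) C0 a0 b0 wC.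
have H2 := paraproduct_amgm x (g - y) (h - m) A0 b0.
have H3 := paraproduct_amgm y (f - x) (k - m') A0 a0.
have A2 : 0 < A ^+ 2 by rewrite exprn_gt0.
have H4 : A * (2 * l * F - l ^+ 2 * (a + V / A ^+ 2)) <= A * (F ^+ 2 / (a + V / A ^+ 2)).
  rewrite ler_wpM2l ?(ltW A0)//; apply: tangent_le_sqr_div.
    by rewrite addr_ge0// divr_ge0// ltW.
  move=> /eqP; rewrite paddr_eq0 ?divr_ge0 ?(ltW A2)// => /andP[/eqP az _].
  by rewrite Fa az mulr0.
have H5 : A * (2 * e * G - e ^+ 2 * (b + U / A ^+ 2)) <= A * (G ^+ 2 / (b + U / A ^+ 2)).
  rewrite ler_wpM2l ?(ltW A0)//; apply: tangent_le_sqr_div.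
    by rewrite addr_ge0// divr_ge0// ltW.
  move=> /eqP; rewrite paddr_eq0 ?divr_ge0 ?(ltW A2)// => /andP[/eqP bz _].
  by rewrite Gb bz mulr0.
have H6 : x ^+ 2 / (4 * A) * (b * (h - m) ^+ 2) <= l ^+ 2 / A * (b * (h - m) ^+ 2).
  by apply: ler_wpM2r; [rewrite mulr_ge0// sqr_ge0|exact: quarter_sqr_div_le].
have H7 : y ^+ 2 / (4 * A) * (a * (k - m') ^+ 2) <= e ^+ 2 / A * (a * (k - m') ^+ 2).
  by apply: ler_wpM2r; [rewrite mulr_ge0// sqr_ge0|exact: quarter_sqr_div_le].
rewrite /bellman_step -/m -/m'.
(* The second moment over the child about the parent's mean is the child's variance plus b (h -
   m)^2; the latter is the Carleson decrement. *)
have -> : N2 + 2 * de * t + de ^+ 2 * b - 2 * tau * (t + de * b) + tau ^+ 2 * b =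
    V + b * (h - m) ^+ 2.
  have -> : N2 = V + t / b * t by rewrite /V; ring.
  rewrite de_def /h /m; set T2 := t / b in tb *; rewrite tb; ring.
have -> : N1 + 2 * de' * t + de' ^+ 2 * a - 2 * tau' * (t + de' * a) + tau' ^+ 2 * a =
    U + a * (k - m') ^+ 2.
  have -> : N1 = U + t / a * t by rewrite /U; ring.
  rewrite de'_def /k /m'; set T1 := t / a in ta *; rewrite ta; ring.
(* The increment is (f g - x y) w, split into the diagonal (f - x)(g - y) w and two paraproducts. *)
have -> : B + kappa * (F / n - x * c1) * G + kappa * x * c1 * G
      - x * y * (t + de * b + kappa * c1 * b) =
    (B - f * g * t) + ((f - x) * (g - y) * w + x * (g - y) * w + y * (f - x) * w).
  by rewrite de_def /w {1}Fa {1 2}Gb; ring.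
(* Centring [h] at [m] leaves a multiple of G - y b, which cancels a linear term of [bellman_step]
   and sums to zero over the children. *)
have -> : x * (g - y) * w = x * (g - y) * (b * (h - m)) + x * m * (G - y * b).
  by rewrite wh {1}Gb; ring.
have -> : y * (f - x) * w = y * (f - x) * (a * (k - m')) + y * m' * (F - x * a).
  by rewrite wk {1}Fa; ring.
have -> : A * (P - 2 * l * F + l ^+ 2 * (a + (V + b * (h - m) ^+ 2) / A ^+ 2)) =
   A * P - A * (2 * l * F - l ^+ 2 * (a + V / A ^+ 2)) + l ^+ 2 / A * (b * (h - m) ^+ 2).
  by field; rewrite gt_eqF.
have -> : A * (Q - 2 * e * G + e ^+ 2 * (b + (U + a * (k - m') ^+ 2) / A ^+ 2)) =
   A * Q - A * (2 * e * G - e ^+ 2 * (b + U / A ^+ 2)) + e ^+ 2 / A * (a * (k - m') ^+ 2).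
  by field; rewrite gt_eqF.
have -> : P - 2 * x * F + x ^+ 2 * a + (Q - 2 * y * G + y ^+ 2 * b) =
  P - F ^+ 2 / a + (Q - G ^+ 2 / b) + (a * (f - x) ^+ 2 + b * (g - y) ^+ 2).
  by rewrite F2 G2 Fa Gb; ring.
move: IH H1 H2 H3 H4 H5 H6 H7.
rewrite !mulrDl !mulrBr.
move: (F ^+ 2 / (a + V / A ^+ 2)) (G ^+ 2 / (b + U / A ^+ 2)) => Z1 Z2.
lra.
Qed.

(** At the parent's own parameters every tangent touches its quotient and the linear corrections
    vanish. *)
Lemma bellman_step_parent A C kappa c1 c2 (a b F G P Q t N2 N1 B : R) :
  0 < A -> 0 <= a -> 0 <= b ->
  F ^+ 2 <= P * a -> G ^+ 2 <= Q * b -> 0 <= N2 -> 0 <= N1 ->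
  t ^+ 2 <= N2 * b -> t ^+ 2 <= N1 * a ->
  0 <= bellman_step A C (F / a) (G / b)
    (F / (a + (N2 - t ^+ 2 / b) / A ^+ 2)) (G / (b + (N1 - t ^+ 2 / a) / A ^+ 2))
    (t / b) (t / a) kappa c1 c2 a b F G P Q B t t N2 N1 ->
  bellman_bound A C a b F G P Q t N2 N1 B.
Proof.
move=> A0 a0 b0 FP GQ N20 N10 tN2 tN1.
have Fa : F = F / a * a.
  by apply: divfK0 => az; apply: (sqr_le0_eq0 FP); rewrite az mulr0.
have Gb : G = G / b * b.
  by apply: divfK0 => bz; apply: (sqr_le0_eq0 GQ); rewrite bz mulr0.
have tb : t = t / b * b.
  by apply: divfK0 => bz; apply: (sqr_le0_eq0 tN2); rewrite bz mulr0.
have ta : t = t / a * a.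
  by apply: divfK0 => az; apply: (sqr_le0_eq0 tN1); rewrite az mulr0.
set V := N2 - t ^+ 2 / b; set U := N1 - t ^+ 2 / a.
set v := a + V / A ^+ 2; set u := b + U / A ^+ 2; rewrite /bellman_bound -/V -/U -/v -/u.
have sum_eq0 p q : 0 <= p -> 0 <= q -> p + q / A ^+ 2 = 0 -> p = 0.
  move=> p0 q0 /eqP; rewrite paddr_eq0 ?divr_ge0 ?sqr_ge0//.
  by move=> /andP[/eqP].
have V0 : 0 <= V := sub_sqr_div_ge0 b0 N20 tN2.
have U0 : 0 <= U := sub_sqr_div_ge0 a0 N10 tN1.
have Fv : F = F / v * v by apply: divfK0 => /(sum_eq0 _ _ a0 V0) az; rewrite Fa az mulr0.
have Gu : G = G / u * u by apply: divfK0 => /(sum_eq0 _ _ b0 U0) bz; rewrite Gb bz mulr0.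
rewrite /bellman_step.
have -> : N2 - 2 * (t / b) * t + (t / b) ^+ 2 * b = V.
  have -> : (t / b) ^+ 2 * b = t / b * (t / b * b) by ring.
  by rewrite -tb /V; ring.
have -> : N1 - 2 * (t / a) * t + (t / a) ^+ 2 * a = U.
  have -> : (t / a) ^+ 2 * a = t / a * (t / a * a) by ring.
  by rewrite -ta /U; ring.
rewrite -/v -/u.
have vertex z p s : p = p / s * s -> z - 2 * (p / s) * p + (p / s) ^+ 2 * s = z - p ^+ 2 / s.
  move=> ps; have -> : (p / s) ^+ 2 * s = p / s * (p / s * s) by ring.
  by rewrite -ps; ring.
rewrite !vertex// -Fa -Gb !subrr !mulr0 !addr0.
have -> : B + kappa * (F / a) * c1 * G - F / a * (G / b) * (t + kappa * c1 * b)
   = B - F / a * (G / b) * t.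
  have -> : F / a * (G / b) * (t + kappa * c1 * b) =
     F / a * (G / b) * t + kappa * (F / a) * c1 * (G / b * b) by ring.
  by rewrite -Gb; ring.
by rewrite subr_ge0.
Qed.

(* [N <= A^2 a] makes the denominator at most [2 a]: this is the factor 4 of the
   Carleson embedding theorem. *)
Lemma optimal_slope_ge A a b F t N : 0 < A -> 0 <= a -> 0 <= b -> 0 <= N ->
  (a = 0 -> F = 0) -> t ^+ 2 <= N * b -> N <= A ^+ 2 * a ->
  (F / a) ^+ 2 <= 4 * (F / (a + (N - t ^+ 2 / b) / A ^+ 2)) ^+ 2.
Proof.
move=> A0 a0 b0 N0 Fa tN Na; set V := N - _.
have A2 : 0 < A ^+ 2 by rewrite exprn_gt0.
have V0 : 0 <= V := sub_sqr_div_ge0 b0 N0 tN.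
have [az|an0] := eqVneq a 0; first by rewrite Fa// !mul0r expr0n mulr0.
have {}a0 : 0 < a by rewrite lt_neqAle eq_sym an0.
set v := a + _.
have v2 : v <= 2 * a.
  rewrite /v -lerBrDl ler_pdivrMr//.
  have -> : (2 * a - a) * A ^+ 2 = A ^+ 2 * a by ring.
  apply: le_trans Na; rewrite lerBlDr lerDl mulr_ge0 ?sqr_ge0// invr_ge0//.
have v0 : 0 < v by rewrite ltr_pwDl// divr_ge0// ltW.
rewrite !expr_div_n.
have -> : 4 * (F ^+ 2 / v ^+ 2) = F ^+ 2 * (4 / v ^+ 2) by ring.
rewrite ler_wpM2l ?sqr_ge0// ler_pdivlMr ?exprn_gt0// mulrC ler_pdivrMr ?exprn_gt0//.
nra.
Qed.

(** The testing bound gives |t| <= A sqrt(a b), so x y t costs at most (A/2)(F^2/a + G^2/b), which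
    the negative terms of the first line absorb. *)
Lemma bellman_bound_conclusion A C (a b F G P Q t N2 N1 B : R) :
  0 < A -> A <= C -> 0 <= a -> 0 <= b ->
  F ^+ 2 <= P * a -> G ^+ 2 <= Q * b -> 0 <= N2 -> 0 <= N1 ->
  t ^+ 2 <= N2 * b -> t ^+ 2 <= N1 * a -> N2 <= A ^+ 2 * a ->
  bellman_bound A C a b F G P Q t N2 N1 B ->
  B <= (C + 4 * A) / 2 * (P + Q).
Proof.
move=> A0 AC a0 b0 FP GQ N20 N10 tN2 tN1 N2a; rewrite /bellman_bound.
set V := N2 - _; set U := N1 - _.
have A2 : 0 < A ^+ 2 by rewrite exprn_gt0.
have V0 : 0 <= V := sub_sqr_div_ge0 b0 N20 tN2.
have U0 : 0 <= U := sub_sqr_div_ge0 a0 N10 tN1.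
have tab : t ^+ 2 <= A ^+ 2 * (a * b).
  by apply: le_trans tN2 _; rewrite mulrA ler_wpM2r.
have H1 := weighted_amgm (F / a) (G / b) (ltW A0) a0 b0 tab.
have Fa : F = F / a * a.
  by apply: divfK0 => az; apply: (sqr_le0_eq0 FP); rewrite az mulr0.
have Gb : G = G / b * b.
  by apply: divfK0 => bz; apply: (sqr_le0_eq0 GQ); rewrite bz mulr0.
have EF : a * (F / a) ^+ 2 = F ^+ 2 / a.
  have -> : a * (F / a) ^+ 2 = F / a * (F / a * a) by ring.
  by rewrite -Fa; ring.
have EG : b * (G / b) ^+ 2 = G ^+ 2 / b.
  have -> : b * (G / b) ^+ 2 = G / b * (G / b * b) by ring.
  by rewrite -Gb; ring.
have F0 : 0 <= F ^+ 2 / a by rewrite mulr_ge0 ?sqr_ge0// invr_ge0.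
have G0 : 0 <= G ^+ 2 / b by rewrite mulr_ge0 ?sqr_ge0// invr_ge0.
have FV0 : 0 <= A * (F ^+ 2 / (a + V / A ^+ 2)).
  by rewrite mulr_ge0 ?(ltW A0)// mulr_ge0 ?sqr_ge0// invr_ge0 addr_ge0// divr_ge0// ltW.
have GU0 : 0 <= A * (G ^+ 2 / (b + U / A ^+ 2)).
  by rewrite mulr_ge0 ?(ltW A0)// mulr_ge0 ?sqr_ge0// invr_ge0 addr_ge0// divr_ge0// ltW.
have CA : A * (F ^+ 2 / a + G ^+ 2 / b) <= C * (F ^+ 2 / a + G ^+ 2 / b).
  by rewrite ler_wpM2r// addr_ge0.
have AF : 0 <= A * (F ^+ 2 / a + G ^+ 2 / b).
  by rewrite mulr_ge0 ?(ltW A0)// addr_ge0.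
move: H1 CA AF FV0 GU0; rewrite EF EG !mulrBr !mulrDl.
move: (F ^+ 2 / a) (G ^+ 2 / b) (F ^+ 2 / _) (G ^+ 2 / _) => Z1 Z2 Z3 Z4.
lra.
Qed.

Lemma bellman_bound_leaf A C (a b F G P Q : R) :
  0 < A -> 0 <= C -> 0 <= a -> 0 <= b -> F ^+ 2 <= P * a -> G ^+ 2 <= Q * b ->
  0 <= P -> 0 <= Q ->
  bellman_bound A C a b F G P Q 0 0 0 0.
Proof.
move=> A0 C0 a0 b0 FP GQ P0 Q0; rewrite /bellman_bound.
rewrite expr0n !mul0r mulr0 !subr0 !mul0r !addr0.
have div_le p z s : 0 <= s -> 0 <= z -> p ^+ 2 <= z * s -> 0 <= z - p ^+ 2 / s.
  move=> s0 z0 pz; rewrite subr_ge0.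
  have := s0; rewrite le_eqVlt => /predU1P[<-|s1]; first by rewrite invr0 mulr0.
  by rewrite ler_pdivrMr.
have HF := div_le _ _ _ a0 P0 FP; have HG := div_le _ _ _ b0 Q0 GQ.
have CA : 0 <= C / 2 + A by lra.
have := mulr_ge0 CA (addr_ge0 HF HG).
have := mulr_ge0 (ltW A0) HF; have := mulr_ge0 (ltW A0) HG; lra.
Qed.
End BellmanAlgebra.

(** * Induction over the levels *)

Lemma sqr_add_le (R : realFieldType) (A c p t s : R) : 0 <= A -> 0 <= c -> 0 <= p ->
  t ^+ 2 <= A ^+ 2 * p -> s ^+ 2 <= c ^+ 2 * p -> (t + s) ^+ 2 <= (c + A) ^+ 2 * p.
Proof.
move=> A0 c0 p0 tA sc.
have ts : t * s <= A * c * p.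
  apply: le_trans (ler_norm _) _.
  rewrite -ler_sqr ?nnegrE ?mulr_ge0// real_normK ?num_real//.
  have -> : (A * c * p) ^+ 2 = (A ^+ 2 * p) * (c ^+ 2 * p) by ring.
  by rewrite exprMn ler_pM// sqr_ge0.
have -> : (t + s) ^+ 2 = t ^+ 2 + 2 * (t * s) + s ^+ 2 by ring.
have -> : (c + A) ^+ 2 * p = A ^+ 2 * p + 2 * (A * c * p) + c ^+ 2 * p by ring.
lra.
Qed.

(** With its parameters frozen, [bellman_step] is linear in its last eleven arguments; this is the
    purpose of the tangent form. *)
Lemma cadd_bellman_step (d : measure_display) (T : measurableType d) (R : realType)
    (e : nat -> set T) (I : set T) (A C x y l s tau tau' kappa c1 c2 : R)
    (a b F G P Q UG H K HH KK : set T -> R) :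
  let cadd := countably_additive_along e I in
  cadd a -> cadd b -> cadd F -> cadd G -> cadd P -> cadd Q -> cadd UG ->
  cadd H -> cadd K -> cadd HH -> cadd KK ->
  cadd (fun J => bellman_step A C x y l s tau tau' kappa c1 c2
    (a J) (b J) (F J) (G J) (P J) (Q J) (UG J) (H J) (K J) (HH J) (KK J)).
Proof.
move=> /= *; rewrite /bellman_step.
repeat match goal with
| H : countably_additive_along _ _ ?p |- countably_additive_along _ _ (fun J => ?p J) => exact H
| |- countably_additive_along _ _ (fun J => @?p J - @?q J) => apply: (caddB (psi := p) (phi := q))
| |- countably_additive_along _ _ (fun J => @?p J + @?q J) => apply: (caddD (psi := p) (phi := q))
| |- countably_additive_along _ _ (fun J => ?r * @?p J) => apply: (caddZ (c := r) (psi := p))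
| |- countably_additive_along _ _ (fun J => @?p J / ?r) => apply: (caddZr (c := r^-1) (psi := p))
end.
Qed.

Section Multipliers.
Context {d : measure_display} {T : measurableType d} {R : realType}.
Variables (nu : {measure set T -> \bar R}) (D : int -> set (set T)).
Hypothesis HD : atomic_filtration nu D.
Variable sigma : set T -> R.
Hypothesis sigma_le1 : forall I, Dall D I -> `|sigma I| <= 1.
Variable M : int.

Local Notation one := (fun=> 1 : R).

(** * Local square integrability and the one-level recursion of [Tlev] *)

Section OneDirection.
Variables mu mu' : {measure set T -> \bar R}.
Hypothesis mu_fin : forall I, Dall D I -> (mu I < +oo)%E.
Hypothesis mu'_fin : forall I, Dall D I -> (mu' I < +oo)%E.
Variable c : R.
Hypothesis A2c : forall I, Dall D I ->
  msr mu I * msr mu' I <= c ^+ 2 * (msr nu I) ^+ 2.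

Lemma ip_one I : Dall D I -> ip mu I one one = msr mu I.
Proof.
move=> DI; rewrite /ip mulr1 Rintegral_cst ?mul1r//; exact: (Dall_meas HD).
Qed.

Lemma avgE f I : avg nu f mu I = ip mu I f one / msr nu I.
Proof. by rewrite /avg /ip; under [in RHS]eq_Rintegral do rewrite mulr1. Qed.

Lemma ip0l I g : ip mu I (fun=> 0) g = 0.
Proof.
rewrite /ip; under eq_Rintegral do rewrite mul0r.
by rewrite /Rintegral integral0.
Qed.

Lemma integral_sqr_ip f I : locL2 D mu f -> Dall D I ->
  (\int[mu]_(x in I) (f x ^+ 2)%:E)%E = (ip mu I f f)%:E.
Proof.
move=> hf DI; rewrite /ip /Rintegral fineK.
  by apply: eq_integral => x _; rewrite expr2.
exact: (integrable_fin_num (Dall_meas HD DI) (locL2_mul HD hf hf DI)).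
Qed.

(** The function is constant on each level m atom J. By Cauchy-Schwarz its square integral over J is
    at most mu(J) mu'(J) / nu(J)^2 times that of f, hence at most c^2 times it. *)
Lemma locL2_avg n m f : n <= m -> locL2 D mu f ->
  locL2 D mu' (fun x => sigma (atom_at D n x) * avg nu f mu (atom_at D m x)).
Proof.
move=> nm hf; apply: (@locL2_of_level _ _ _ _ _ HD mu mu' m f _ (c ^+ 2)) => //.
- exact: sqr_ge0.
- apply: (atomwise_const_measurable HD (n := m)) => I x y DI Ix Iy.
  rewrite !(atom_at_eq HD DI)//; congr (sigma _ * _).
  have [Da ax] := atom_atP HD n x.
  rewrite (atom_at_eq HD Da)//.
  by apply: (nested HD nm Da DI) => //; exists x.
move=> J DJ; have DallJ : Dall D J by exists m.
have [z Jz] := atom_nonempty HD DallJ.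
pose s := sigma (atom_at D n z) * avg nu f mu J.
have mJ := Dall_meas HD DallJ.
rewrite (eq_integral (fun=> (s ^+ 2)%:E)); last first.
  move=> x; rewrite inE => Jx; rewrite (atom_at_eq HD DJ Jx) /s.
  have [Da ax] := atom_atP HD n z.
  rewrite (@atom_at_eq _ _ _ _ _ HD n (atom_at D n z) x)//.
  by apply: (nested HD nm Da DJ) => //; exists z.
have fin' := mu'_fin DallJ.
have fin'E : mu' J = (msr mu' J)%:E by rewrite /msr fineK// ge0_fin_numE.
rewrite integral_cst// integral_sqr_ip// fin'E -!EFinM lee_fin.
have nu0 := nu_atom_gt0 HD DJ.
have sig2 : sigma (atom_at D n z) ^+ 2 <= 1.
  rewrite -real_normK ?num_real// expr_le1//; apply: sigma_le1.
  by exists n => //; exact: (atom_atP HD n z).1.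
have CS := cauchy_schwarz HD DallJ hf (locL2_cst HD mu_fin 1).
have b0 : 0 <= msr mu' J by rewrite /msr fine_ge0.
apply: (@le_trans _ _ (ip mu J f one ^+ 2 / msr nu J ^+ 2 * msr mu' J)).
  rewrite ler_wpM2r// /s exprMn avgE expr_div_n ler_piMl//.
  by rewrite divr_ge0// sqr_ge0.
apply: (@le_trans _ _ (ip mu J f f * msr mu J / msr nu J ^+ 2 * msr mu' J)).
  by rewrite ler_wpM2r// ler_wpM2r ?invr_ge0 ?sqr_ge0// -ip_one.
rewrite [leLHS](_ : _ = ip mu J f f * (msr mu J * msr mu' J / msr nu J ^+ 2)); last ring.
rewrite mulrC ler_wpM2r ?ip_ge0// ler_pdivrMr ?exprn_gt0//.
exact: A2c.
Qed.

Lemma locL2_Tlev f k : locL2 D mu f -> locL2 D mu' (Tlev nu D sigma f mu M k).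
Proof.
move=> hf; elim: k => [|k IH] /=; first exact: (locL2_cst HD mu'_fin).
apply: (locL2D HD) => //.
rewrite (_ : (fun x => _) = (fun x =>
   sigma (atom_at D (level M k.+1) x) * avg nu f mu (atom_at D (level M k) x) +
   -1 * (sigma (atom_at D (level M k.+1) x) * avg nu f mu (atom_at D (level M k.+1) x)))).
  by apply: (locL2D HD); [|apply: (locL2Z HD)]; apply: locL2_avg => //;
     rewrite /level; lia.
by apply/funext => x; ring.
Qed.

Lemma Tlev_succ f k I J x : D (level M k.+1) I -> D (level M k) J -> J `<=` I -> J x ->
  Tlev nu D sigma f mu M k.+1 x =
  sigma I * (avg nu f mu J - avg nu f mu I) * 1 + Tlev nu D sigma f mu M k x.
Proof.
move=> DI DJ JI Jx /=.
by rewrite mulr1 (atom_at_eq HD DI (JI _ Jx)) (atom_at_eq HD DJ Jx).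
Qed.

Lemma ip_Tlev_succ f g k I J : locL2 D mu f -> locL2 D mu' g ->
  D (level M k.+1) I -> D (level M k) J -> J `<=` I ->
  ip mu' J (Tlev nu D sigma f mu M k.+1) g = ip mu' J (Tlev nu D sigma f mu M k) g +
    sigma I * (avg nu f mu J - avg nu f mu I) * ip mu' J g one.
Proof.
move=> hf hg DI DJ JI; have DallJ : Dall D J by exists (level M k).
rewrite (eq_ip mu' _ (fun x => Tlev_succ f DI DJ JI)) (ip_addZ HD)//.
- by rewrite addrC (ipC _ _ one).
- exact: (locL2_cst HD).
- exact: locL2_Tlev.
Qed.

Lemma ip_sqr_Tlev_succ f k I J : locL2 D mu f ->
  D (level M k.+1) I -> D (level M k) J -> J `<=` I ->
  let e := sigma I * (avg nu f mu J - avg nu f mu I) in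
  ip mu' J (Tlev nu D sigma f mu M k.+1) (Tlev nu D sigma f mu M k.+1) =
   ip mu' J (Tlev nu D sigma f mu M k) (Tlev nu D sigma f mu M k)
   + 2 * e * ip mu' J (Tlev nu D sigma f mu M k) one + e ^+ 2 * ip mu' J one one.
Proof.
move=> hf DI DJ JI e; have DallJ : Dall D J by exists (level M k).
rewrite (eq_ip mu' _ (fun x => Tlev_succ f DI DJ JI)) ipC.
rewrite (eq_ip mu' _ (fun x => Tlev_succ f DI DJ JI)) (ip_sqr_addZ HD)//.
- rewrite -/e (ipC _ _ one); ring.
- exact: (locL2_cst HD).
- exact: locL2_Tlev.
Qed.
End OneDirection.

(** * The Bellman induction and the resulting norm bound *)

Section TwoMeasures.
Variables mu1 mu2 : {measure set T -> \bar R}.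
Hypothesis mu1_fin : forall I, Dall D I -> (mu1 I < +oo)%E.
Hypothesis mu2_fin : forall I, Dall D I -> (mu2 I < +oo)%E.
Variables c A : R.
Hypothesis c_ge0 : 0 <= c.
Hypothesis A_gt0 : 0 < A.
Hypothesis A2c : forall I, Dall D I ->
  msr mu1 I * msr mu2 I <= c ^+ 2 * (msr nu I) ^+ 2.

Let h := Tlev nu D sigma one mu1 M.
Let h' := Tlev nu D sigma one mu2 M.

Hypothesis testing : forall k I, D (level M k) I ->
  ip mu2 I (h k) (h k) <= A ^+ 2 * ip mu1 I one one.
Hypothesis testing' : forall k I, D (level M k) I ->
  ip mu1 I (h' k) (h' k) <= A ^+ 2 * ip mu2 I one one.

Lemma A2c' I : Dall D I -> msr mu2 I * msr mu1 I <= c ^+ 2 * (msr nu I) ^+ 2.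
Proof. by rewrite mulrC; exact: A2c. Qed.

Let one1 : locL2 D mu1 one := locL2_cst HD mu1_fin 1.
Let one2 : locL2 D mu2 one := locL2_cst HD mu2_fin 1.
Let hL2 k : locL2 D mu2 (h k) := locL2_Tlev mu1_fin mu2_fin A2c k one1.
Let h'L2 k : locL2 D mu1 (h' k) := locL2_Tlev mu2_fin mu1_fin A2c' k one2.

(** Formal self-adjointness of T_I, obtained level by level. *)
Lemma testing_sym k I : D (level M k) I -> ip mu2 I (h k) one = ip mu1 I (h' k) one.
Proof.
elim: k I => [|k IH] I DI; first by rewrite !ip0l.
have DallI : Dall D I by exists (level M k.+1).
have ll : level M k.+1 <= level M k by rewrite /level; lia.
have [e [te me Ue eD]] := atom_enum HD ll DI.
have cadd1 f g := @cadd_ip _ _ _ _ _ HD mu1 I e f g te me Ue DallI.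
have cadd2 f g := @cadd_ip _ _ _ _ _ HD mu2 I e f g te me Ue DallI.
pose c1 := sigma I * (ip mu1 I one one / msr nu I).
pose c2 := sigma I * (ip mu2 I one one / msr nu I).
have Z : c1 * ip mu2 I one one = c2 * ip mu1 I one one by rewrite /c1 /c2; ring.
(* On a child J each bracket is its level k pairing plus sigma_I mu1(J) mu2(J) / nu(J), which is
   symmetric in the measures; over [I] the corrections agree by [Z]. *)
have step : countably_additive_along e I (fun J => (ip mu2 J (h k.+1) one + c1 * ip mu2 J one one)
   - (ip mu1 J (h' k.+1) one + c2 * ip mu1 J one one)).
  apply: caddB; apply: caddD; rewrite //.
  - exact: cadd2.
  - by apply: caddZ; exact: cadd2.
  - exact: cadd1.
  - by apply: caddZ; exact: cadd1.
have H := cadd_eq0 step; apply/eqP; rewrite -subr_eq0 -H; last first.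
  move=> i; case: (eD i) => [->|[DJ JI]]; first by rewrite !ip0 !mulr0 !addr0 subrr.
  rewrite (ip_Tlev_succ mu1_fin mu2_fin A2c one1 one2 DI DJ JI).
  rewrite (ip_Tlev_succ mu2_fin mu1_fin A2c' one2 one1 DI DJ JI).
  by rewrite -/(h k) -/(h' k) (IH _ DJ) !avgE /c1 /c2; ring.
by rewrite Z; apply/eqP; ring.
Qed.

Variable f : T -> R.
Hypothesis hf : locL2 D mu1 f.
Let u := Tlev nu D sigma f mu1 M.
Let uL2 k : locL2 D mu2 (u k) := locL2_Tlev mu1_fin mu2_fin A2c k hf.

Section Bilinear.
Variable g : T -> R.
Hypothesis hg : locL2 D mu2 g.

Lemma bellman_induction k I : D (level M k) I ->
  bellman_bound A (c + A) (ip mu1 I one one) (ip mu2 I one one)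
    (ip mu1 I f one) (ip mu2 I g one) (ip mu1 I f f) (ip mu2 I g g)
    (ip mu2 I (h k) one) (ip mu2 I (h k) (h k)) (ip mu1 I (h' k) (h' k))
    (ip mu2 I (u k) g).
Proof.
elim: k I => [|k IH] I DI.
  have DallI : Dall D I by exists (level M 0).
  rewrite /h /h' /u !ip0l; apply: bellman_bound_leaf; rewrite ?ip_ge0 ?addr_ge0 ?(ltW A_gt0)//.
  - exact: (cauchy_schwarz HD).
  - exact: (cauchy_schwarz HD).
have DallI : Dall D I by exists (level M k.+1).
have ll : level M k.+1 <= level M k by rewrite /level; lia.
have [e [te me Ue eD]] := atom_enum HD ll DI.
have cadd1 p q := @cadd_ip _ _ _ _ _ HD mu1 I e p q te me Ue DallI.
have cadd2 p q := @cadd_ip _ _ _ _ _ HD mu2 I e p q te me Ue DallI.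
pose kappa := sigma I.
pose c1 := ip mu1 I one one / msr nu I.
pose c2 := ip mu2 I one one / msr nu I.
have tN2 j J : Dall D J -> ip mu2 J (h j) one ^+ 2 <= ip mu2 J (h j) (h j) * ip mu2 J one one.
  by move=> DJ; apply: (cauchy_schwarz HD).
have tN1 j J : D (level M j) J ->
    ip mu2 J (h j) one ^+ 2 <= ip mu1 J (h' j) (h' j) * ip mu1 J one one.
  by move=> DJ; rewrite testing_sym//; apply: (cauchy_schwarz HD) => //; exists (level M j).
apply: (bellman_step_parent (kappa := kappa) (c1 := c1) (c2 := c2));
  rewrite ?ip_ge0//.
- exact: (cauchy_schwarz HD).
- exact: (cauchy_schwarz HD).
- exact: tN2.
- exact: tN1.
set x := _ / _; set y := ip mu2 I g one / _; set l := _ / _; set s := _ / (ip mu2 I one one + _).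
set tau := _ / ip mu2 I one one; set tau' := _ / ip mu1 I one one.
(* The parameters are those of [I], but the set argument varies, so [Psi] can be checked on each
   child and then summed. *)
pose Psi J := bellman_step A (c + A) x y l s tau tau' kappa c1 c2
  (ip mu1 J one one) (ip mu2 J one one) (ip mu1 J f one) (ip mu2 J g one)
  (ip mu1 J f f) (ip mu2 J g g) (ip mu2 J (u k.+1) g) (ip mu2 J (h k.+1) one)
  (ip mu1 J (h' k.+1) one) (ip mu2 J (h k.+1) (h k.+1)) (ip mu1 J (h' k.+1) (h' k.+1)).
suff : 0 <= Psi I by rewrite /Psi -testing_sym.
have FI : ip mu1 I f one = x * ip mu1 I one one.
  by apply: divfK0 => z; apply: (sqr_le0_eq0 (cauchy_schwarz HD DallI hf one1)); rewrite z mulr0.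
have GI : ip mu2 I g one = y * ip mu2 I one one.
  by apply: divfK0 => z; apply: (sqr_le0_eq0 (cauchy_schwarz HD DallI hg one2)); rewrite z mulr0.
have xl : x ^+ 2 <= 4 * l ^+ 2.
  apply: optimal_slope_ge; rewrite ?ip_ge0//.
  - by move=> z; rewrite FI z mulr0.
  - exact: tN2.
  - exact: testing.
have ys : y ^+ 2 <= 4 * s ^+ 2.
  apply: optimal_slope_ge; rewrite ?ip_ge0//.
  - by move=> z; rewrite GI z mulr0.
  - exact: tN1.
  - exact: testing'.
apply: (@cadd_ge0 _ _ _ e).
  apply: cadd_bellman_step; [exact: cadd1|exact: cadd2|exact: cadd1|exact: cadd2|
    exact: cadd1|exact: cadd2|exact: cadd2|exact: cadd2|exact: cadd1|exact: cadd2|exact: cadd1].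
move=> i; case: (eD i) => [->|[DJ JI]].
  suff -> : Psi set0 = 0 by [].
  by rewrite /Psi /bellman_step !ip0; ring.
set J := e i in DJ JI *; have DallJ : Dall D J by exists (level M k).
rewrite /Psi /u /h /h'.
rewrite (ip_Tlev_succ mu1_fin mu2_fin A2c hf hg DI DJ JI).
rewrite (ip_Tlev_succ mu1_fin mu2_fin A2c one1 one2 DI DJ JI).
rewrite (ip_Tlev_succ mu2_fin mu1_fin A2c' one2 one1 DI DJ JI).
rewrite (ip_sqr_Tlev_succ mu1_fin mu2_fin A2c one1 DI DJ JI).
rewrite (ip_sqr_Tlev_succ mu2_fin mu1_fin A2c' one2 DI DJ JI).
rewrite -/(u k) -/(h k) -/(h' k) -(testing_sym DJ) !avgE.
have -> : ip mu1 I f one / msr nu I = x * c1 by rewrite FI /c1 mulrA.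
have nuJ := nu_atom_gt0 HD DJ.
apply: (@bellman_step_child _ _ _ _ _ _ _ _ _ _ _ _ (msr nu J)
  _ _ _ _ _ _ _ _ _ _ _ _ A_gt0) => //; rewrite ?ip_ge0 ?addr_ge0 ?(ltW A_gt0)//.
- exact: (cauchy_schwarz HD).
- exact: (cauchy_schwarz HD).
- exact: tN2.
- exact: tN1.
(* Origin of C = c + A: testing bounds the first summand by A sqrt(a b), and the A_2 condition with
   |kappa| <= 1 bounds the second by c sqrt(a b). *)
- have a0 := ip_ge0 mu1 J one; have b0 := ip_ge0 mu2 J one.
  have ab0 := mulr_ge0 a0 b0.
  apply: sqr_add_le => //; first exact: ltW.
    apply: le_trans (tN2 _ _ DallJ) _; rewrite mulrA ler_wpM2r//; exact: testing.
  have kappa1 : kappa ^+ 2 <= 1.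
    by rewrite -real_normK ?num_real// expr_le1//; exact: sigma_le1.
  have ab : ip mu1 J one one * ip mu2 J one one <= c ^+ 2 * msr nu J ^+ 2.
    by rewrite !ip_one//; exact: A2c.
  have -> : (kappa * ip mu1 J one one * ip mu2 J one one / msr nu J) ^+ 2 =
      kappa ^+ 2 * ((ip mu1 J one one * ip mu2 J one one) ^+ 2 / msr nu J ^+ 2).
    by field; rewrite gt_eqF.
  move: ab0 ab; set p := _ * ip mu2 J _ _ => p0 pc.
  apply: (@le_trans _ _ (1 * (p ^+ 2 / msr nu J ^+ 2))).
    by rewrite ler_wpM2r// divr_ge0 ?sqr_ge0.
  rewrite mul1r ler_pdivrMr ?exprn_gt0// expr2.
  rewrite [leRHS](_ : _ = c ^+ 2 * msr nu J ^+ 2 * p); last ring.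
  by rewrite ler_wpM2r.
- exact: IH.
Qed.

Lemma bilinear_bound k I : D (level M k) I ->
  ip mu2 I (u k) g <= (c + 5 * A) / 2 * (ip mu1 I f f + ip mu2 I g g).
Proof.
move=> DI; have DallI : Dall D I by exists (level M k).
rewrite (_ : c + 5 * A = (c + A) + 4 * A); last ring.
apply: (bellman_bound_conclusion A_gt0 _ _ _ _ _ _ _ _ _ _ (bellman_induction DI));
  rewrite ?ip_ge0 ?lerDr//.
- exact: (cauchy_schwarz HD).
- exact: (cauchy_schwarz HD).
- exact: (cauchy_schwarz HD).
- by rewrite testing_sym//; exact: (cauchy_schwarz HD).
- exact: testing.
Qed.
End Bilinear.

Lemma local_bound k I : D (level M k) I ->
  ip mu2 I (u k) (u k) <= (c + 5 * A) ^+ 2 * ip mu1 I f f.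
Proof.
move=> DI; have DallI : Dall D I by exists (level M k).
set L := c + 5 * A.
have L0 : 0 < L by rewrite ltr_wpDl// mulr_gt0.
(* With g = u / L the bound reads X / L <= (L/2)(P + X / L^2); multiplied by 2 L, it yields X <= L^2
   P. *)
have := @bilinear_bound (fun x => L^-1 * u k x) (locL2Z HD L^-1 (uL2 k)) k I DI.
have hLu := locL2Z HD L^-1 (uL2 k).
rewrite (ipC _ _ (u k)) !(ipZl HD)// (ipC _ _ (u k)) !(ipZl HD)// -/L.
set X := ip mu2 I (u k) (u k); set P := ip mu1 I f f => H.
have {}H : L^-1 * X * (2 * L) <= L / 2 * (P + L^-1 * (L^-1 * X)) * (2 * L).
  by rewrite ler_wpM2r// mulr_ge0// ltW.
move: H.
have -> : L^-1 * X * (2 * L) = 2 * X by field; rewrite gt_eqF.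
have -> : L / 2 * (P + L^-1 * (L^-1 * X)) * (2 * L) = L ^+ 2 * P + X.
  by field; rewrite gt_eqF.
lra.
Qed.

Lemma global_bound k :
  (\int[mu2]_x (u k x ^+ 2)%:E <= ((c + 5 * A) ^+ 2)%:E * \int[mu1]_x (f x ^+ 2)%:E)%E.
Proof.
have [e [te me Ue eD]] := level_enum HD (level M k).
have K0 : (0 <= ((c + 5 * A) ^+ 2)%:E :> \bar R)%E by rewrite lee_fin sqr_ge0.
have msq (v : T -> R) : measurable_fun setT v ->
    measurable_fun setT (fun x => (v x ^+ 2)%:E).
  by move=> mv; apply/measurable_EFinP; exact: measurable_funX.
have sq0 (v : T -> R) x : (0 <= (v x ^+ 2)%:E)%E by rewrite lee_fin sqr_ge0.
have toint J : measurable J -> (\int[mu1]_(x in J) (((c + 5 * A) ^+ 2)%:E * (f x ^+ 2)%:E) =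
    ((c + 5 * A) ^+ 2)%:E * \int[mu1]_(x in J) (f x ^+ 2)%:E)%E.
  by move=> mJ; apply: ge0_integralZl => //; exact: measurable_funTS (msq _ hf.1).
rewrite -toint// -Ue; apply: ge0_le_integral_bigcup => //.
- exact: msq (uL2 k).1.
- by apply/measurable_EFinP; apply: measurable_funM => //; apply: measurable_funX; exact: hf.1.
- by move=> x; rewrite mule_ge0.
- move=> i; rewrite toint//; case: (eD i) => [->|DJ].
    by rewrite !integral_set0 mule0.
  have DallJ : Dall D (e i) by exists (level M k).
  rewrite (integral_sqr_ip (uL2 k))// (integral_sqr_ip hf)// -EFinM lee_fin.
  exact: local_bound.
Qed.
End TwoMeasures.
End Multipliers.

(** * Reduction of the theorem to a finite range of levels *)

Section L2norm.
Context {d : measure_display} {T : measurableType d} {R : realType}.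
Implicit Types mu : {measure set T -> \bar R}.

Lemma L2normE mu (f : T -> R) :
  L2norm mu f = sqrte (\int[mu]_x ((f x) ^+ 2)%:E)%E.
Proof.
have I0 : (0 <= \int[mu]_x ((f x) ^+ 2)%:E)%E.
  by apply: integral_ge0 => x _; rewrite lee_fin sqr_ge0.
rewrite unlock poweR12_sqrt.
  congr sqrte; apply: eq_integral => x _ /=.
  by rewrite powR_mulrn// real_normK ?num_real.
by apply: integral_ge0 => x _; rewrite poweR_ge0.
Qed.

Lemma L2norm_le_sqr mu (f : T -> R) (K : R) : (L2norm mu f <= K%:E)%E ->
  (\int[mu]_x ((f x) ^+ 2)%:E <= (K ^+ 2)%:E)%E.
Proof.
move=> fK; have K0 : 0 <= K.
  by rewrite -lee_fin; apply: le_trans fK; exact: Lnorm_ge0.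
by rewrite -lee_sqrt ?lee_fin ?sqr_ge0//= sqrtr_sqr ger0_norm// -L2normE.
Qed.

Lemma sqr_le_L2norm mu1 mu2 (f u : T -> R) (K : R) : 0 <= K ->
  (\int[mu2]_x (u x ^+ 2)%:E <= (K ^+ 2)%:E * \int[mu1]_x (f x ^+ 2)%:E)%E ->
  (L2norm mu2 u <= K%:E * L2norm mu1 f)%E.
Proof.
move=> K0 H; have I0 : (0 <= \int[mu1]_x ((f x) ^+ 2)%:E)%E.
  by apply: integral_ge0 => x _; rewrite lee_fin sqr_ge0.
have K2 : (0 <= (K ^+ 2)%:E)%E by rewrite lee_fin sqr_ge0.
have -> : K%:E = sqrte (K ^+ 2)%:E by rewrite /= sqrtr_sqr ger0_norm.
by rewrite !L2normE -sqrteM// lee_sqrt// mule_ge0.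
Qed.

Lemma L2norm_locL2 (D : int -> set (set T)) mu (f : T -> R) :
  (forall I, Dall D I -> measurable I) -> measurable_fun setT f ->
  (L2norm mu f < +oo)%E -> locL2 D mu f.
Proof.
move=> mD mf; rewrite L2normE => fin; split=> // I DI.
apply: (@le_lt_trans _ _ (\int[mu]_x ((f x) ^+ 2)%:E)%E).
  apply: ge0_subset_integral => //; first exact: mD.
    by apply/measurable_EFinP; exact: measurable_funX.
  by move=> x _; rewrite lee_fin sqr_ge0.
by move: fin; case: (\int[mu]_x _)%E => //= r _; rewrite ltry.
Qed.
End L2norm.

Section Reduction.
Context {d : measure_display} {T : measurableType d} {R : realType}.
Variables (nu : {measure set T -> \bar R}) (D : int -> set (set T)).
Hypothesis HD : atomic_filtration nu D.
Variable sigma : set T -> R.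

Lemma rank_bounds : finite_set [set I | Dall D I /\ sigma I != 0] ->
  exists M K, forall I n, rkp D I n -> sigma I != 0 -> level M K <= n /\ n < M.
Proof.
move=> /finite_seqP[s sE].
pose r I := xget (0 : int) [set n | rkp D I n].
pose B := (\sum_(I <- s) `|r I|)%N.
(* These choices make [level M K] equal to -B, and each relevant rank lies between -B and B. *)
exists (B%:Z + 1), (B + B + 1)%N => I n rI sI.
have Is : I \in s.
  by have : [set` s] I by rewrite -sE; split=> //; exists n => //; case: rI.
have <- : r I = n.
  by rewrite /r; case: xgetP => [m _ rm|/(_ n)//]; exact: (rkp_uniq rm rI).
have : (`|r I| <= B)%N.
  by rewrite /B (big_rem _ Is) /= leq_addr.
rewrite /level; lia.
Qed.

(** The recursion only sees atoms inside the starting one; this allows 1_I to be replaced by the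
    constant 1. *)
Lemma eq_Tlev f f' mu M k x : (forall y, atom_at D (level M k) x y -> f y = f' y) ->
  Tlev nu D sigma f mu M k x = Tlev nu D sigma f' mu M k x.
Proof.
have eq_avg I : (forall y, I y -> f y = f' y) -> avg nu f mu I = avg nu f' mu I.
  by move=> ff; rewrite /avg; congr (_ / _); apply: eq_Rintegral => y; rewrite inE => /ff ->.
elim: k => [//|k IH] ff /=.
have ff' y : atom_at D (level M k) x y -> f y = f' y.
  by rewrite levelS => /(atom_at_succ HD)/ff.
by rewrite IH// !eq_avg.
Qed.

(** * From the testing conditions in norm to bounds on pairings *)

Section Testing.
Variable M : int.
Hypothesis Sfin : finite_set [set I | Dall D I /\ sigma I != 0].
Hypothesis rank_lt : forall I n, rkp D I n -> sigma I != 0 -> n < M.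

Lemma TI_indic mu k I : D (level M k) I ->
  TI D nu sigma I \1_I mu = fun x => Tlev nu D sigma (fun=> 1) mu M k x * \1_I x.
Proof.
move=> DI; apply/funext => x; rewrite indicE.
have [Ix|nIx] := pselect (I x); last first.
  rewrite memNset// mulr0; apply: fsbig1 => J [_ JI].
  by rewrite (@DeltaI_out _ _ _ nu D)// ?mulr0// => /JI.
rewrite mem_set// mulr1 -{1}(atom_at_eq HD DI Ix) (TI_Tlev HD)//.
apply: eq_Tlev => y; rewrite (atom_at_eq HD DI Ix) => Iy.
by rewrite indicE mem_set.
Qed.

Lemma testing_ip (mu mu' : {measure set T -> \bar R}) (A A' : R) k I : D (level M k) I ->
  (mu I < +oo)%E -> locL2 D mu' (Tlev nu D sigma (fun=> 1) mu M k) ->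
  A <= A' -> 0 < A' ->
  (L2norm mu' (TI D nu sigma I \1_I mu) <= (A * Num.sqrt (fine (mu I)))%:E)%E ->
  ip mu' I (Tlev nu D sigma (fun=> 1) mu M k) (Tlev nu D sigma (fun=> 1) mu M k)
    <= A' ^+ 2 * ip mu I (fun=> 1) (fun=> 1).
Proof.
move=> DI muI; set h := Tlev _ _ _ _ _ _ _ => hL2 AA A0 test.
have DallI : Dall D I by exists (level M k).
have s0 : 0 <= A * Num.sqrt (fine (mu I)).
  by rewrite -lee_fin; apply: le_trans test; exact: Lnorm_ge0.
have a0 : 0 <= msr mu I by rewrite /msr fine_ge0.
have mI := Dall_meas HD DallI.
have mh : measurable_fun setT (fun x => ((h x * \1_I x) ^+ 2)%:E).
  apply/measurable_EFinP; apply: measurable_funX; apply: measurable_funM => //.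
  exact: hL2.1.
rewrite (ip_one HD)// -lee_fin -(integral_sqr_ip HD hL2)//.
apply: (@le_trans _ _ (((A * Num.sqrt (fine (mu I))) ^+ 2)%:E)).
  apply: le_trans (L2norm_le_sqr test); rewrite (TI_indic mu DI) -/h.
  rewrite (eq_integral (fun x => ((h x * \1_I x) ^+ 2)%:E)); last first.
    by move=> x; rewrite indicE => ->; rewrite mulr1.
  apply: ge0_subset_integral => // x _.
  by rewrite lee_fin sqr_ge0.
rewrite lee_fin; apply: (@le_trans _ _ ((A' * Num.sqrt (fine (mu I))) ^+ 2)).
  have s1 : 0 <= A' * Num.sqrt (fine (mu I)) by rewrite mulr_ge0 ?sqrtr_ge0// ltW.
  by apply: lerXn2r; rewrite ?nnegrE// ler_wpM2r ?sqrtr_ge0.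
by rewrite exprMn sqr_sqrtr.
Qed.
End Testing.
End Reduction.

Lemma A2_bound (d : measure_display) (T : measurableType d) (R : realType)
    (nu : {measure set T -> \bar R}) (D : int -> set (set T))
    (mu1 mu2 : {measure set T -> \bar R}) I :
  atomic_filtration nu D -> (A2 D nu mu1 mu2 < +oo)%E -> Dall D I ->
  msr mu1 I * msr mu2 I <= Num.sqrt (fine (A2 D nu mu1 mu2)) ^+ 2 * msr nu I ^+ 2.
Proof.
move=> HD A2oo DI.
have nu0 : 0 < msr nu I by case: DI => n _; exact: (nu_atom_gt0 HD).
have le : ((msr mu1 I * msr mu2 I / msr nu I ^+ 2)%:E <= A2 D nu mu1 mu2)%E.
  by apply: ereal_sup_ubound; exists I.
have fin : A2 D nu mu1 mu2 \is a fin_num.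
  by rewrite fin_numE (lt_eqF A2oo) andbT; apply/eqP => E; rewrite E in le.
move: le; rewrite -[leRHS]fineK// lee_fin => le.
rewrite sqr_sqrtr; first by rewrite -ler_pdivrMr ?exprn_gt0.
apply: le_trans le; rewrite divr_ge0 ?sqr_ge0//.
by rewrite mulr_ge0// /msr fine_ge0.
Qed.

Unset Implicit Arguments.
Set Strict Implicit.

Theorem theorem8p1 (d : measure_display) (T : measurableType d) (R : realType)
    (nu : {measure set T -> \bar R}) (D : int -> set (set T))
    (sigma : set T -> R) (mu1 mu2 : {measure set T -> \bar R}) (A : R) :
  atomic_filtration nu D ->
  finite_set [set I | Dall D I /\ sigma I != 0] ->
  (forall I, Dall D I -> `|sigma I| <= 1) ->
  (* mu1, mu2 are finite on atoms *)
  (forall I, Dall D I -> (mu1 I < +oo)%E /\ (mu2 I < +oo)%E) ->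
  (A2 D nu mu1 mu2 < +oo)%E ->
  (forall I, Dall D I ->
     (L2norm mu2 (TI D nu sigma I \1_I mu1) <= (A * Num.sqrt (fine (mu1 I)))%:E)%E) ->
  (forall I, Dall D I ->
     (L2norm mu1 (TI D nu sigma I \1_I mu2) <= (A * Num.sqrt (fine (mu2 I)))%:E)%E) ->
  forall f : T -> R, measurable_fun setT f -> (L2norm mu1 f < +oo)%E ->
    (L2norm mu2 (Tsig D nu sigma f mu1)
      <= (2 * Num.sqrt (fine (A2 D nu mu1 mu2)) + 5 * A)%:E * L2norm mu1 f)%E.
Proof.
move=> HD Sfin sigma1 mufin A2oo test1 test2 f mf fin.
have fin1 I : Dall D I -> (mu1 I < +oo)%E by move=> /mufin[].
have fin2 I : Dall D I -> (mu2 I < +oo)%E by move=> /mufin[].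
have [M [K rank]] := rank_bounds Sfin.
have rank_lt I n : rkp D I n -> sigma I != 0 -> n < M.
  by move=> rI sI; case: (rank I n rI sI).
have rank_ge I n : rkp D I n -> sigma I != 0 -> level M K <= n.
  by move=> rI sI; case: (rank I n rI sI).
set c := Num.sqrt _.
have c0 : 0 <= c := sqrtr_ge0 _.
have A2c I : Dall D I -> msr mu1 I * msr mu2 I <= c ^+ 2 * msr nu I ^+ 2.
  exact: A2_bound.
have A2c' I : Dall D I -> msr mu2 I * msr mu1 I <= c ^+ 2 * msr nu I ^+ 2.
  by rewrite mulrC; exact: A2c.
have hf := L2norm_locL2 (fun I => @Dall_meas _ _ _ _ _ HD I) mf fin.
(* The Bellman function divides by A^2, so the estimate is first proved for every positive A' >=
   A. *)
have bound A' : A <= A' -> 0 < A' ->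
    (L2norm mu2 (Tsig D nu sigma f mu1) <= (c + 5 * A')%:E * L2norm mu1 f)%E.
  move=> AA A'0; apply: sqr_le_L2norm.
    by rewrite addr_ge0// mulr_ge0// ltW.
  rewrite (_ : Tsig D nu sigma f mu1 = Tlev nu D sigma f mu1 M K); last first.
    by apply/funext => x; exact: (Tsig_Tlev HD).
  apply: (global_bound HD sigma1 fin1 fin2 c0 A'0 A2c _ _ hf) => k I DI.
  - apply: (testing_ip HD Sfin rank_lt DI _ _ AA A'0).
    + by apply: fin1; exists (level M k).
    + exact: (locL2_Tlev HD sigma1 _ fin1 fin2 A2c _ (locL2_cst HD fin1 1)).
    + by apply: test1; exists (level M k).
  - apply: (testing_ip HD Sfin rank_lt DI _ _ AA A'0).
    + by apply: fin2; exists (level M k).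
    + exact: (locL2_Tlev HD sigma1 _ fin2 fin1 A2c' _ (locL2_cst HD fin2 1)).
    + by apply: test2; exists (level M k).
have [r finE] : exists r, L2norm mu1 f = r%:E.
  by exists (fine (L2norm mu1 f)); rewrite fineK// ge0_fin_numE// Lnorm_ge0.
have : 0 <= r by rewrite -lee_fin -finE Lnorm_ge0.
rewrite finE in bound *.
rewrite le_eqVlt => /predU1P[rz|r0].
  have A'0 : 0 < `|A| + 1 by rewrite ltr_wpDl.
  apply: le_trans (bound (`|A| + 1) _ A'0) _; last by rewrite -rz !mule0.
  by apply: le_trans (ler_norm A) _; rewrite lerDl.
(* A negative [A] would force mu1 to vanish on all atoms, hence f to have norm zero. *)
have A0 : 0 <= A.
  rewrite leNgt; apply/negP => Aneg.
  have null I : Dall D I -> mu1 I = 0%E.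
    move=> DI; have : (0 <= (A * Num.sqrt (fine (mu1 I)))%:E)%E.
      by apply: le_trans (test1 I DI); exact: Lnorm_ge0.
    rewrite lee_fin nmulr_rge0// => s0.
    have : fine (mu1 I) <= 0.
      by rewrite -sqrtr_eq0 eq_le s0 sqrtr_ge0.
    rewrite -lee_fin fineK ?ge0_fin_numE ?fin1// => le0.
    by apply/eqP; rewrite eq_le le0 measure_ge0.
  have [e [te me Ue eD]] := level_enum HD 0.
  have msq : measurable_fun setT (fun x => (f x ^+ 2)%:E).
    by apply/measurable_EFinP; exact: measurable_funX.
  have : (\int[mu1]_x (f x ^+ 2)%:E <= 0)%E.
    apply: (@le_trans _ _ (\int[mu1]_(x in \bigcup_k e k) cst 0%E x)%E).
      rewrite -Ue; apply: ge0_le_integral_bigcup => //.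
        by move=> x; rewrite lee_fin sqr_ge0.
      move=> k; rewrite integral_cst// mul0e.
      case: (eD k) => [->|Dk]; first by rewrite integral_set0.
      rewrite null_set_integral//; first exact: measurable_funTS.
      by apply: null; exists 0.
    by rewrite integral_cst ?mul0e//; apply: bigcup_measurable.
  move=> I0; have : (L2norm mu1 f <= 0)%E.
    by rewrite L2normE -sqrte0 lee_sqrt.
  by rewrite finE lee_fin leNgt r0.
apply/lee_addgt0Pr => eps eps0.
(* Increasing [A] by eps / (5 r) raises the right-hand side by exactly eps. *)
have de0 : 0 < eps / (5 * r) by rewrite divr_gt0// mulr_gt0.
apply: le_trans (bound (A + eps / (5 * r)) _ _) _.
- by rewrite lerDl ltW.
- by rewrite ltr_wpDl.
rewrite -!EFinM -EFinD lee_fin.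
have -> : (c + 5 * (A + eps / (5 * r))) * r = (c + 5 * A) * r + eps.
  by field; rewrite gt_eqF.
rewrite lerD2r ler_wpM2r ?(ltW r0)// lerD2r; lra.
Qed.
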